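(* Let $\ell\ge 2$ and let $k_1,\dots,k_\ell$ be positive integers, all of the same parity, such that the value $1$ occurs at most once among them. Let $\Theta_{k_1,\dots,k_\ell}$ denote the graph obtained by fixing two vertices $p$ and $p'$ and connecting them by $\ell$ internally vertex-disjoint paths of lengths (numbers of edges) $k_1,\dots,k_\ell$ respectively. Put $k^\ast=\frac12\min_{1\le i<j\le \ell}(k_i+k_j)$. Then $$\mathrm{ex}(n,\Theta_{k_1,\dots,k_\ell})=O\big(n^{1+\frac{1}{k^\ast}}\big),$$ where the implied constant depends only on $k_1,\dots,k_\ell$.
   Context: For a graph $H$, $\mathrm{ex}(n,H)$ denotes the maximum number of edges in a graph on $n$ vertices that contains no subgraph isomorphic to $H$. *)

(* Defs.v *)
From HB Require Import structures.
From mathcomp Require Import all_boot all_order all_algebra.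
From mathcomp Require Import reals exp.
Set Implicit Arguments. Unset Strict Implicit. Unset Printing Implicit Defensive.
Import Order.TTheory GRing.Theory Num.Theory.

(* A simple graph on a finite type T is a symmetric irreflexive relation. *)

Definition num_edges (T : finType) (e : rel T) : nat :=
  #|[set E : {set T} | [exists x : T, [exists y : T,
        (x != y) && e x y && (E == [set x; y])]]]|.

Definition contains_subgraph (T H : finType) (eG : rel T) (eH : rel H) : Prop :=
  exists f : H -> T, injective f /\ forall x y, eH x y -> eG (f x) (f y).

(* Theta graph Theta_{k_1,...,k_l}.  Vertices: inl false = p, inl true = p',
   and for path i the k_i - 1 internal vertices (i, j), j < k_i - 1, where
   (i, j) is the vertex at distance j+1 from p along path i. *)
Definition theta_vertex (l : nat) (k : 'I_l -> nat) : finType :=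
  (bool + {i : 'I_l & 'I_(k i).-1})%type.

Definition theta_at (l : nat) (k : 'I_l -> nat) (i : 'I_l) (t : nat)
  : theta_vertex k :=
  if t == 0%N then inl false
  else if (k i <= t)%N then inl true
  else match @insub nat (fun m => (m < (k i).-1)%N) 'I_(k i).-1 t.-1 with
       | Some j => inr (@Tagged 'I_l i (fun i => 'I_(k i).-1) j)
       | None => inl true
       end.

Definition theta_adj (l : nat) (k : 'I_l -> nat) : rel (theta_vertex k) :=
  fun u v => [exists i : 'I_l, [exists t : 'I_(k i),
     ((theta_at k i t == u) && (theta_at k i t.+1 == v)) ||
     ((theta_at k i t == v) && (theta_at k i t.+1 == u))]].

(* 2 k^* = min_{i<j} (k_i + k_j); the default value \sum_i k_i is an upper
   bound for every pair sum, so it never affects the result when l >= 2. *)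
Definition theta_min_pair_sum (l : nat) (k : 'I_l -> nat) : nat :=
  \big[minn/(\sum_(i < l) k i)%N]_(ij : 'I_l * 'I_l | (ij.1 < ij.2)%N)
     (k ij.1 + k ij.2)%N.

Definition kstar (R : realType) (l : nat) (k : 'I_l -> nat) : R :=
  ((theta_min_pair_sum k)%:R / 2)%R.

Arguments theta_vertex {l} k.
Arguments theta_at {l} k i t.
Arguments theta_adj {l} k u v.
Arguments theta_min_pair_sum {l} k.
Arguments kstar R {l} k.
Arguments num_edges {T} e.
Arguments contains_subgraph {T H} eG eH.

(* Main.v *)
(** Write [k_1] for the smallest length and [2k] for the smallest sum of two
    lengths, so that the other lengths are at least [2k - k_1].

    Passing to a smallest vertex set that is too dense, deleting its vertices of
    large degree, pruning those of small degree and taking a maximum cut leaves a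
    bipartite graph on a set [U] with degrees between [d] and [K d], where [d^k]
    is a large multiple of [|U|].  Take a breadth-first search tree in it.  If the
    pairs of consecutive levels [L_i], [L_(i+1)] with [i < k] spanned only
    [O(|L_i| + |L_(i+1)|)] edges, the levels would grow by a factor of order [d],
    and level [k] would not fit into [U].

    So some pair is dense.  Each [w] in [L_(i+1)] keeps a positive proportion of
    its neighbours in [L_i], having a common ancestor [h] steps up but many
    distinct ancestors [h-1] steps up; pigeonhole makes [h] the same for all [w],
    and pruning makes the degrees large.  In this graph one can grow disjoint legs
    of any length, ending in [L_i] in pairwise different branches below a common
    ancestor [y].  If [h < k_1], legs of lengths [k_a - h] from one vertex, extended
    by tree paths to [y], form the theta graph.  If [h >= k_1], the other hub is a
    tree vertex [b] lying [k_1] steps below [y]: the shortest path is the tree path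
    from [y] to [b], and path [a] goes from [b] down the tree to [L_i], along a leg
    of length [k_a + k_1 - 2h >= 2], and up to [y].  A vertex [b] with enough active
    children exists because otherwise the kept part of [L_i] would have only
    [O((K d)^(i-1))] vertices, too few for its number of edges. *)

Require Import Defs.
From HB Require Import structures.
From mathcomp Require Import all_boot all_order all_algebra.
From mathcomp Require Import reals exp.
From mathcomp Require Import zify.
Import Order.TTheory GRing.Theory Num.Theory.

(** * Embedding a theta graph given by parametrised paths *)

Section Embedding.
Set Implicit Arguments. Unset Strict Implicit.
Variables (T : finType) (e : rel T).
Hypothesis e_sym : symmetric e.

Lemma theta_atP l (k : 'I_l -> nat) (q : 'I_l -> nat -> T) (p p' : T) i t :
  0 < k i -> q i 0 = p -> q i (k i) = p' -> t <= k i ->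
  match theta_at k i t with
  | inl b => if b then p' else p
  | inr x => q (tag x) (tagged x).+1
  end = q i t.
Proof.
move=> ki0 q0 qk tk; rewrite /theta_at.
case: eqP => [->|/eqP t0] //=.
case: leqP => tk' /=; first by have -> : t = k i by lia.
case: insubP => [j _ /= jE|]; last by move=> h; exfalso; lia.
by rewrite jE prednK // lt0n.
Qed.

(** Describing path [i] by a function [q i] of the position confines the dependent type of internal
    vertices to this proof; later only positions are compared. *)
Lemma theta_contains l (k : 'I_l -> nat) (q : 'I_l -> nat -> T) (p p' : T) :
  (forall i, 0 < k i) -> p <> p' ->
  (forall i, q i 0 = p) -> (forall i, q i (k i) = p') ->
  (forall i t, t < k i -> e (q i t) (q i t.+1)) ->
  (forall i t, 0 < t < k i -> q i t <> p /\ q i t <> p') ->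
  (forall i j s t, 0 < s < k i -> 0 < t < k j -> q i s = q j t ->
     i = j /\ s = t) ->
  contains_subgraph e (theta_adj k).
Proof.
move=> k0 pp' q0 qk qe qint qinj.
pose f (u : theta_vertex k) := match u with
  | inl b => if b then p' else p
  | inr x => q (tag x) (tagged x).+1 end.
have fE i t : t <= k i -> f (theta_at k i t) = q i t by move=> ?; exact: theta_atP.
have rng (x : {i : 'I_l & 'I_(k i).-1}) : 0 < (tagged x).+1 < k (tag x).
  by case: x => i [j jl] /=; lia.
exists f; split.
  move=> [b|x] [b'|x'] //=.
  - by case: b; case: b' => // h; case: pp'.
  - by have [h1 h2] := qint _ _ (rng x'); case: b => /esym.
  - by have [h1 h2] := qint _ _ (rng x); case: b'.
  - move=> /(qinj _ _ _ _ (rng x) (rng x')) [].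
    case: x => i j; case: x' => i' j' /= ii'; subst i' => [] [jj'].
    by congr (inr (Tagged _ _)); apply: val_inj.
move=> u v /existsP[i /existsP[t /orP[]/andP[/eqP<- /eqP<-]]];
  have tk := ltn_ord t; rewrite !fE ?(ltnW tk) // ?(e_sym _ (q i t)); exact: qe.
Qed.

End Embedding.

(** * Greedy growth of disjoint legs *)

Section Linkage.
Set Implicit Arguments. Unset Strict Implicit.
Variables (T : finType) (e : rel T) (br : T -> T) (A B Q : {set T}) (D : nat).
Hypothesis degA : forall s, s \in A -> D <= #|[set w in B | e s w]|.
Hypothesis degB : forall s, s \in B -> D <= #|[set v in A | e s v]|.
Hypothesis branchB :
  forall s, s \in B -> D <= #|br @: [set v in Q | e s v]|.

Lemma exists_fresh (X Z : {set T}) : #|Z| < #|X| -> exists2 x, x \in X & x \notin Z.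
Proof.
move=> ZX; have /set0Pn[x] : X :\: Z != set0.
  rewrite -card_gt0 cardsD subn_gt0; apply: leq_ltn_trans ZX.
  exact/subset_leq_card/subsetIr.
by rewrite inE => /andP[xZ xX]; exists x.
Qed.

(** [r] lists the vertices after the start [s], so the leg has [m] edges. The whole leg avoids the
    vertices of [Z]; its end also avoids their branches. *)
Definition good_leg (Z : {set T}) m s (r : seq T) :=
  [/\ size r = m, path e s r, uniq r,
      {in r, forall x, x \notin Z /\ x \in A :|: B :|: Q} &
      last s r \in Q /\ br (last s r) \notin br @: Z].

(** The leg alternates between [A] and [B] and takes its last edge from [B] into [Q], so the parity
    of [m] fixes the side of [s]. Every step has at least [D] candidates, and the forbidden set
    gains one vertex per step. *)
Lemma greedy_leg m s (Z : {set T}) :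
  0 < m -> s \in (if odd m then B else A) -> #|Z| + m <= D ->
  exists r, good_leg Z m s r.
Proof.
elim: m s Z => // m IH s Z _ sAB ZD.
case: m => [|m] in IH sAB ZD *.
  (* At the last edge a fresh branch is picked; its vertex is then fresh as well. *)
  have [] := @exists_fresh (br @: [set v in Q | e s v]) (br @: Z).
    apply: leq_ltn_trans (leq_imset_card _ _) _.
    by apply: leq_trans (branchB sAB); lia.
  move=> _ /imsetP[u + ->] uZ; rewrite inE => /andP[uQ su].
  exists [:: u]; split => //=; rewrite ?su //.
  move=> x; rewrite inE => /eqP ->; split; last by rewrite inE uQ orbT.
  by apply: contraNN uZ => /imset_f.
have [x xX xZ] : exists2 x,
    x \in (if odd m.+1 then B else A) /\ e s x & x \notin Z.
  move: sAB => /=; rewrite negbK; case: (odd m) => /= sAB.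
  - have [|x] := @exists_fresh [set v in A | e s v] Z.
      by apply: leq_trans (degB sAB); lia.
    by rewrite inE => /andP[xA sx] xZ; exists x.
  - have [|x] := @exists_fresh [set v in B | e s v] Z.
      by apply: leq_trans (degA sAB); lia.
    by rewrite inE => /andP[xA sx] xZ; exists x.
case: xX => xX sx.
have [|r [rm rp ru rZ [rQ rb]]] := IH x (x |: Z) isT xX.
  by rewrite cardsU1 xZ; lia.
exists (x :: r); split => //=; rewrite ?rm ?sx ?rp ?ru ?andbT //.
- by apply/negP => /rZ; rewrite setU11 => -[].
- move=> z; rewrite inE => /predU1P[->|/rZ[]].
    by split=> //; move: xX; rewrite !inE; case: ifP => _ ->; rewrite ?orbT.
  by rewrite inE negb_or => /andP[].
split => //; apply: contraNN rb; apply/subsetP/imsetS/subsetUr.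
Qed.

(** Legs are chosen one after the other, each forbidding its vertices to the later ones. Legs have
    positive length, so the end of a leg is among its own vertices and its branch becomes forbidden
    too. *)
Lemma linkage (I : eqType) (c : seq I) (s : I -> T) (m : I -> nat) (Z : {set T}) :
  uniq c -> (forall a, a \in c -> 0 < m a) ->
  (forall a, a \in c -> s a \in (if odd (m a) then B else A)) ->
  #|Z| + \sum_(a <- c) m a <= D ->
  exists r : I -> seq T,
    (forall a, a \in c -> good_leg Z (m a) (s a) (r a)) /\
    (forall a a', a \in c -> a' \in c -> a != a' ->
       [disjoint r a & r a'] /\ br (last (s a) (r a)) <> br (last (s a') (r a'))).
Proof.
elim: c Z => [|a c IH] Z /=; first by move=> *; exists (fun=> [::]).
case/andP=> ac uc m0 sAB; rewrite big_cons => ZD.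
have [|rr rrP] := greedy_leg (m0 _ (mem_head _ _)) (sAB _ (mem_head _ _)) (Z := Z).
  lia.
have [rrm rrp rru rrZ [rrQ rrb]] := rrP.
have cZ : #|Z :|: [set x in rr]| <= #|Z| + m a.
  apply: leq_trans (leq_card_setU _ _) _; rewrite leq_add2l cardsE.
  by rewrite -rrm card_size.
have [|||r [rP rd]] := IH (Z :|: [set x in rr]) uc.
- by move=> b bc; apply: m0; rewrite inE bc orbT.
- by move=> b bc; apply: sAB; rewrite inE bc orbT.
- lia.
have key b : b \in c ->
    [disjoint rr & r b] /\ br (last (s a) rr) <> br (last (s b) (r b)).
  move=> bc; have [rm rp ru rZ [rQ rb]] := rP _ bc; split.
    rewrite disjoint_sym; apply/pred0P => x /=; apply/negP => /andP[/rZ[+ _] xr].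
    by rewrite !inE xr orbT.
  move=> h; case/negP: rb; apply/imsetP; exists (last (s a) rr) => //.
  case: (rr) rrm => [|x t _]; first by move: (m0 a (mem_head _ _)) => /= + h1; rewrite -h1.
  by rewrite 2!inE /= mem_last orbT.
exists (fun b => if b == a then rr else r b); split.
  move=> b; rewrite inE; case: eqP => [-> //|_ /= /rP[rm rp ru rZ [rQ rb]]].
  split=> //; first by move=> x /rZ; rewrite inE negb_or => -[/andP[]].
  split=> //; apply: contraNN rb; apply/subsetP/imsetS/subsetUl.
move=> b b'; rewrite !inE; case: eqP => [->|_] /=; case: eqP => [->|_] //=.
- by rewrite eqxx.
- by move=> _ /key.
- by move=> /key[h1 h2] _ _; rewrite disjoint_sym; split=> // h; case: h2.
- exact: rd.
Qed.

End Linkage.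

(** * Assembling the theta graph from legs and tree paths *)

Section Assemble.
Set Implicit Arguments. Unset Strict Implicit.
Variables (T : finType) (e : rel T) (lev : nat -> {set T}) (par : T -> T) (i : nat).
Hypothesis e_sym : symmetric e.
Hypothesis lev_inj : forall x j j', x \in lev j -> x \in lev j' -> j = j'.
Hypothesis par_lev : forall j x, j < i -> x \in lev j.+1 ->
  par x \in lev j /\ e x (par x).

Lemma iter_lev x j s : x \in lev j -> s <= j <= i -> iter s par x \in lev (j - s).
Proof.
move=> xj; elim: s => [|s IH] si; first by rewrite subn0.
have /IH : s <= j <= i by lia.
have -> : j - s = (j - s.+1).+1 by lia.
by case/par_lev => //; lia.
Qed.

Lemma iter_edge x j s : x \in lev j -> s < j <= i ->
  e (iter s par x) (iter s.+1 par x).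
Proof.
move=> xj si; have : iter s par x \in lev (j - s) by apply: iter_lev => //; lia.
have -> : j - s = (j - s.+1).+1 by lia.
by case/par_lev => //; lia.
Qed.

Lemma iter_meet x y j s s' : x \in lev j -> y \in lev j -> j <= i ->
  s <= j -> s' <= j -> iter s par x = iter s' par y -> s = s'.
Proof.
move=> xj yj ji sj s'j E.
have := @iter_lev x j s xj; rewrite E => /(_ _)/lev_inj E'.
have := E' _ _ (@iter_lev y j s' yj _); lia.
Qed.

Lemma iter_par_mono x y s n : s <= n -> iter s par x = iter s par y ->
  iter n par x = iter n par y.
Proof. by move=> /subnK <- E; rewrite !iterD E. Qed.

(* Path [a] climbs down the tree from [b] to [v a], follows the leg [r a], and
   climbs up the tree to [y]; the path selected by [sp] is a tree path. *)
Lemma theta_of_linkage l (k : 'I_l -> nat) (g h : nat) (b y : T)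
    (sp : pred 'I_l) (v : 'I_l -> T) (r : 'I_l -> seq T) :
  g < h <= i -> b <> y ->
  (forall a, ~~ sp a -> [/\ k a = g + size (r a) + h, 0 < size (r a),
       path e (v a) (r a) & uniq (r a)]) ->
  (forall a, ~~ sp a -> iter g par (v a) = b) ->
  (forall a, ~~ sp a -> iter h par (last (v a) (r a)) = y) ->
  (forall a, ~~ sp a -> last (v a) (r a) \in lev i) ->
  (forall a x j, ~~ sp a -> x \in r a -> j < i -> x \notin lev j) ->
  (forall a a', ~~ sp a -> ~~ sp a' -> v a \notin r a') ->
  (forall a a', ~~ sp a -> ~~ sp a' ->
     iter h.-1 par (last (v a) (r a)) <> iter h.-1 par (v a')) ->
  (forall a a', ~~ sp a -> ~~ sp a' -> a != a' -> [disjoint r a & r a'] /\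
     iter h.-1 par (last (v a) (r a)) <> iter h.-1 par (last (v a') (r a'))) ->
  (forall a, ~~ sp a -> v a \in lev i \/
     [/\ g = 0, sp =1 pred0 & forall j, j < i -> v a \notin lev j]) ->
  (0 < g -> forall a a', ~~ sp a -> ~~ sp a' -> a != a' ->
     iter g.-1 par (v a) <> iter g.-1 par (v a')) ->
  (forall a, sp a -> [/\ k a = h - g, iter (h - g) par b = y & b \in lev (i - g)]) ->
  (forall a a', sp a -> sp a' -> a = a') ->
  contains_subgraph e (theta_adj k).
Proof.
move=> ghi bney legP legb legy legi legnl vr brv brr vi gv spP sp1.
pose u a := last (v a) (r a).
pose q a t := if sp a then iter t par b else
  if t < g then iter (g - t) par (v a) else
  if t <= g + size (r a) then nth (v a) (v a :: r a) (t - g)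
  else iter (t - g - size (r a)) par (u a).
have vi' a : ~~ sp a -> 0 < g -> v a \in lev i.
  by move=> /vi[//|[-> //]].
have uE a : ~~ sp a -> u a = nth (v a) (v a :: r a) (size (r a)).
  by move=> _; rewrite /u (last_nth (v a)).
have vnl a j : ~~ sp a -> j < i -> v a \notin lev j.
  by move=> /vi[vai|[_ _ +]] ji; [apply/negP => /(lev_inj vai) ?; lia|apply].
have k0 a : 0 < k a.
  by case: (boolP (sp a)) => [/spP[]|/legP[]]; lia.
have memn a n : n < size (r a) -> nth (v a) (r a) n \in r a by exact: mem_nth.
have midnl a j t : ~~ sp a -> t <= size (r a) -> j < i ->
    nth (v a) (v a :: r a) t \notin lev j.
  case: t => [|t] /= sa tr ji; first exact: vnl.
  by apply: (legnl a) => //; apply: mem_nth.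
have down a s : ~~ sp a -> 0 < s <= g -> iter s par (v a) \in lev (i - s).
  by move=> sa sg; apply: iter_lev; [apply: vi'; lia|lia].
have up a s : ~~ sp a -> s <= h -> iter s par (u a) \in lev (i - s).
  by move=> sa sg; apply: iter_lev; [apply: legi|lia].
have spl a s : sp a -> s <= h - g -> iter s par b \in lev (i - (g + s)).
  move=> /spP[_ _ bl] sg; have -> : i - (g + s) = i - g - s by lia.
  by apply: iter_lev => //; lia.
have yl a : ~~ sp a -> y \in lev (i - h) by move=> sa; rewrite -(legy _ sa) up.
have bl a : ~~ sp a -> 0 < g -> b \in lev (i - g).
  by move=> sa g0; rewrite -(legb _ sa) down //; lia.
(* A climb meeting [b] would reach the same ancestor at height [h.-1] as [v a], against the choice
   of branches; for [g = 0] the levels alone exclude it. *)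
have upb a s : ~~ sp a -> 0 < s < h -> iter s par (u a) <> b.
  move=> sa sh; have ul := up a s sa; case: (posnP g) => [g0|g0] E.
    have := legb _ sa; rewrite g0 /= => vb.
    by have := vnl a (i - s) sa; rewrite vb -E ul; lia.
  have sg : s = g.
    by have := lev_inj (ul _); rewrite E => /(_ _ _ (bl _ sa g0)); lia.
  apply: (brv _ _ sa sa); apply: (@iter_par_mono _ _ s); first lia.
  by rewrite E sg legb.
have updown a a' s s' : ~~ sp a -> ~~ sp a' -> s < h -> s' <= g ->
    v a' \in lev i -> iter s par (u a) <> iter s' par (v a').
  move=> sa sa' sh sg va' E.
  have ss' : s = s' by apply: (iter_meet (legi _ sa) va' _ _ _ E); lia.
  apply: (brv _ _ sa sa'); apply: (@iter_par_mono _ _ s); first lia.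
  by rewrite E ss'.
have qint a t : 0 < t < k a -> q a t <> b /\ q a t <> y.
  move=> ta; rewrite /q; case: ifPn => [sa|sa].
    have [kE yE bE] := spP _ sa; split=> E.
      by have := lev_inj (spl _ t sa _); rewrite E => /(_ _ _ bE); lia.
    have := lev_inj (spl _ t sa _); rewrite E -yE => /(_ _ _ (spl _ (h - g) sa _)).
    lia.
  have [kE r0 _ _] := legP _ sa.
  case: ltnP => tg.
    split=> E.
      have := lev_inj (down _ (g - t) sa _); rewrite E => /(_ _ _ (bl _ sa _)); lia.
    have := lev_inj (down _ (g - t) sa _); rewrite E => /(_ _ _ (yl _ sa)); lia.
  case: leqP => tr.
    split=> E; last first.
      have := midnl a (i - h) (t - g) sa; rewrite E (yl _ sa); lia.
    case: (posnP g) => [g0|g0]; last first.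
      have := midnl a (i - g) (t - g) sa; rewrite E (bl _ sa g0); lia.
    have := legb _ sa; rewrite g0 /= => vb.
    case/negP: (vr _ _ sa sa); rewrite [X in X \in _]vb -E g0 subn0.
    by case: (t) ta tr => //= t1 _ tr; apply: memn; lia.
  split; first by apply: upb => //; lia.
  move=> E; have := lev_inj (up a (t - g - size (r a)) sa _).
  by rewrite E => /(_ _ _ (yl _ sa)); lia.
(* Zones number the parts of a path: descent from [b], leg, ascent to [y], and the selected tree
   path. By symmetry only pairs with [zone a t <= zone a' t'] need comparing. *)
pose zone a t := if sp a then 3 else if t < g then 0 else
  if t <= g + size (r a) then 1 else 2.
have qinj a a' t t' : zone a t <= zone a' t' -> 0 < t < k a -> 0 < t' < k a' ->
    q a t = q a' t' -> a = a' /\ t = t'.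
  rewrite /zone /q; case: (boolP (sp a)) => sa; case: (boolP (sp a')) => sa' //.
  - move=> _ ta ta' E; split; first exact: sp1.
    have [kE yE bE] := spP _ sa; have [kE' _ _] := spP _ sa'.
    by apply: (iter_meet bE bE _ _ _ E); lia.
  - by case: ifP => // _; case: ifP.
  - have [kE r0 _ _] := legP _ sa; have [kE' yE bE] := spP _ sa'.
    move=> _ ta ta'; case: ltnP => tg.
      move=> E; have := lev_inj (down a (g - t) sa _); rewrite E.
      by move=> /(_ _ _ (spl _ _ sa' _)); lia.
    case: leqP => tr E.
      by have := midnl a (i - (g + t')) (t - g) sa; rewrite E (spl _ _ sa'); lia.
    have vai : v a \in lev i by case: (vi _ sa) => // -[_ /(_ a')]; rewrite sa'.
    have := lev_inj (up a (t - g - size (r a)) sa _); rewrite E.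
    move=> /(_ _ _ (spl _ t' sa' _)) st.
    (* The selected path runs through ancestors of [v a], so a meeting point would put the end of
       the leg and [v a] in one branch. *)
    case: (brv _ _ sa sa).
    apply: (@iter_par_mono _ _ (t - g - size (r a))); first lia.
    rewrite E -(legb _ sa) -iterD; congr (iter _ par _); lia.
  have [kE r0 _ ur] := legP _ sa; have [kE' r0' _ ur'] := legP _ sa'.
  move=> + ta ta'; case: (ltnP t g) => tg.
    have dl := down a (g - t) sa; case: (ltnP t' g) => tg' _ E.
      have g0 : 0 < g by lia.
      have tt : g - t = g - t'.
        by apply: (iter_meet (vi' _ sa g0) (vi' _ sa' g0) _ _ _ E); lia.
      split; last lia; apply/eqP; apply: contraT => aa'.
      case: (gv g0 a a' sa sa' aa'); apply: (@iter_par_mono _ _ (g - t)); first lia.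
      by rewrite E tt.
    move: E; case: leqP => tr' E.
      by have := midnl a' (i - (g - t)) (t' - g) sa'; rewrite -E dl; lia.
    by case: (updown a' a (t' - g - size (r a')) (g - t)) => //; [lia|lia|apply: vi' => //; lia].
  case: (ltnP t' g) => tg'; first by case: ifP.
  case: (leqP t) => tr; case: (leqP t') => tr' // _ E.
  - case: (boolP (a == a')) => [/eqP aa'|aa'].
      split=> //; subst a'; case: (posnP g) => [g0|g0].
        move: E ta ta' tr tr'; rewrite g0 !subn0 add0n.
        case: (t) => [|x] //; case: (t') => [|x'] //= /eqP E _ _ xr xr'.
        by move: E; rewrite nth_uniq // => /eqP ->.
      move: E => /eqP; rewrite nth_uniq /= ?(vr _ _ sa sa) //; lia.
    exfalso; have [dis _] := brr _ _ sa sa' aa'.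
    have mem c n : 0 < n <= size (r c) -> nth (v c) (v c :: r c) n \in r c.
      by case: n => //= n; exact: mem_nth.
    move: E; case: (posnP (t - g)) => [tg0|tg0]; case: (posnP (t' - g)) => [tg0'|tg0'].
    + rewrite tg0 tg0' /= => E.
      have g0 : 0 < g by lia.
      by case: (gv g0 a a' sa sa' aa'); rewrite E.
    + rewrite tg0 /= => E; case/negP: (vr _ _ sa sa'); rewrite E mem //; lia.
    + rewrite tg0' /= => E; case/negP: (vr _ _ sa' sa); rewrite -E mem //; lia.
    + move=> E; have := pred0P dis (nth (v a) (v a :: r a) (t - g)).
      by rewrite /= {2}E !mem //; lia.
  - exfalso; have := midnl a (i - (t' - g - size (r a'))) (t - g) sa.
    by rewrite E up //; lia.
  have ss : t - g - size (r a) = t' - g - size (r a').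
    by apply: (iter_meet (legi _ sa) (legi _ sa') _ _ _ E); lia.
  case: (boolP (a == a')) => [/eqP aa'|aa'].
    by split=> //; subst a'; lia.
  have [_ []] := brr _ _ sa sa' aa'.
  apply: (@iter_par_mono _ _ (t - g - size (r a))); first lia.
  by rewrite E ss.
apply: (@theta_contains T e e_sym l k q b y) => //.
- move=> a; rewrite /q; case: ifPn => // sa; case: ltnP => g0.
    by rewrite subn0 legb.
  by have := legb _ sa; have -> : g = 0 by lia.
- move=> a; rewrite /q; case: ifPn => [/spP[-> //]|sa].
  have [kE r0 _ ur] := legP _ sa; rewrite kE.
  rewrite ltnNge -addnA leq_addr /= leq_add2l -{2}[size (r a)]addn0 leq_add2l.
  rewrite leqNgt (leq_ltn_trans _ (_ : g < h)) //=; last lia.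
  have -> : g + (size (r a) + h) - g - size (r a) = h by lia.
  exact: legy.
- move=> a t ta; rewrite /q; case: ifPn => [sa|sa].
    have [kE _ bE] := spP _ sa.
    by apply: (iter_edge bE); lia.
  have [kE r0 pr ur] := legP _ sa; case: (ltnP t g) => tg.
    have vai : v a \in lev i by apply: vi' => //; lia.
    have -> : (if t.+1 < g then iter (g - t.+1) par (v a) else
        if t.+1 <= g + size (r a) then nth (v a) (v a :: r a) (t.+1 - g)
        else iter (t.+1 - g - size (r a)) par (u a)) = iter (g - t.+1) par (v a).
      case: ltnP => // gt; have -> : t.+1 = g by lia.
      by rewrite leq_addr subnn.
    have -> : g - t = (g - t.+1).+1 by lia.
    by rewrite e_sym; apply: (iter_edge vai); lia.
  rewrite ltnNge (leq_trans tg (leqnSn t)) /=.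
  case: (ltnP t (g + size (r a))) => tr.
    rewrite (ltnW tr) subSn //=.
    have tr' : t - g < size (r a) by lia.
    move/(pathP (v a)): pr => /(_ _ tr'); done.
  rewrite -{2}[t]addn0.
  have E : (if t <= g + size (r a) then nth (v a) (v a :: r a) (t - g)
     else iter (t - g - size (r a)) par (u a)) = iter (t - g - size (r a)) par (u a).
    case: leqP => // tr'; have -> : t = g + size (r a) by lia.
    by rewrite -addnBAC // subnn add0n subnn /= uE.
  rewrite addn0 E.
  have -> : t.+1 - g - size (r a) = (t - g - size (r a)).+1 by lia.
  by apply: (iter_edge (legi _ sa)); lia.
- move=> a a' t t' ta ta' E.
  case: (leqP (zone a t) (zone a' t')) => [/qinj|/ltnW/qinj]; first exact.
  by move=> /(_ ta' ta (esym E))[-> ->].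
Qed.

End Assemble.

(** * Double counting, pruning and branching *)

Section Counting.
Set Implicit Arguments. Unset Strict Implicit.

Lemma card_fibers (T T' : finType) (f : T -> T') (Q : {set T}) n :
  (forall c, c \in f @: Q -> #|[set x in Q | f x == c]| <= n) ->
  #|Q| <= #|f @: Q| * n.
Proof.
move=> H; rewrite -sum1_card (partition_big_imset f) /=.
apply: leq_trans (_ : \sum_(c in f @: Q) n <= _); last by rewrite sum_nat_const.
apply: leq_sum => c /H; apply: leq_trans.
by rewrite -sum1_card; apply: eq_leq; apply: eq_bigl => x; rewrite inE.
Qed.

Lemma pigeonhole (T T' : finType) (f : T -> T') (Q : {set T}) n :
  0 < #|Q| -> #|f @: Q| <= n -> exists c, #|Q| <= n * #|[set x in Q | f x == c]|.
Proof.
move=> Q0 fQ; case: (boolP [exists c, #|Q| <= n * #|[set x in Q | f x == c]|]).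
  by move/existsP.
rewrite negb_exists => /forallP H.
have n0 : 0 < n.
  apply: leq_trans fQ; rewrite card_gt0; apply/set0Pn.
  by move: Q0; rewrite card_gt0 => /set0Pn[x /(imset_f f)]; exists (f x).
have := @card_fibers _ _ f Q (#|Q|.-1 %/ n) _.
have step c : #|[set x in Q | f x == c]| <= #|Q|.-1 %/ n.
  by rewrite leq_divRL //; have := H c; rewrite -ltnNge; lia.
move=> /(_ (fun c _ => step c)) h.
have : #|Q| <= n * (#|Q|.-1 %/ n) by apply: leq_trans h _; rewrite leq_mul2r fQ orbT.
by have := leq_divM (#|Q|.-1) n; lia.
Qed.

Lemma card_pairs_snd (T : finType) (P : {set T * T}) :
  #|P| = \sum_w #|[set v | (v, w) \in P]|.
Proof.
transitivity (\sum_w \sum_v ((v, w) \in P : nat)).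
  rewrite exchange_big pair_big /= -sum1_card big_mkcond /=.
  by apply: eq_bigr => -[v w] _ /=; case: ifP.
apply: eq_bigr => w _; rewrite -sum1_card [RHS]big_mkcond /=.
by apply: eq_bigr => v _; rewrite inE; case: ((_, _) \in P).
Qed.

Lemma card_pairs_fst (T : finType) (P : {set T * T}) :
  #|P| = \sum_v #|[set w | (v, w) \in P]|.
Proof.
transitivity (\sum_v \sum_w ((v, w) \in P : nat)).
  rewrite pair_big /= -sum1_card big_mkcond /=.
  by apply: eq_bigr => -[v w] _ /=; case: ifP.
apply: eq_bigr => w _; rewrite -sum1_card [RHS]big_mkcond /=.
by apply: eq_bigr => v _; rewrite inE; case: ((_, _) \in P).
Qed.

Lemma leq_sum_const (T : finType) (X : {set T}) (F : T -> nat) n :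
  (forall x, x \in X -> F x <= n) -> (forall x, x \notin X -> F x = 0) ->
  \sum_x F x <= #|X| * n.
Proof.
move=> H H0; rewrite (bigID (mem X)) /= [X in _ + X]big1 ?addn0; last exact: H0.
by rewrite -sum_nat_const; apply: leq_sum.
Qed.

Definition incident (T : finType) (P : {set T * T}) (u : T) : {set T * T} :=
  [set p in P | (p.1 == u) || (p.2 == u)].

(** [U] maximises the number of pairs kept plus [D] for each vertex removed. Comparison with [X]
    bounds the loss, and comparison with [U :\ u] bounds the degree of [u]. *)
Lemma prune (T : finType) (P : {set T * T}) (X : {set T}) D :
  P \subset setX X X ->
  exists U : {set T}, [/\ U \subset X,
    #|P| <= #|P :&: setX U U| + D * #|X| &
    forall u, u \in U -> D <= #|incident (P :&: setX U U) u|].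
Proof.
move=> PX; pose f (U : {set T}) := #|P :&: setX U U| + D * #|X :\: U|.
case: (@arg_maxnP _ X (fun U => U \subset X) f (subxx X)) => U UX Umax.
exists U; split => //.
  have := Umax X (subxx X); rewrite /f setDv cards0 muln0 addn0.
  rewrite (setIidPl PX) => /leq_trans; apply.
  by rewrite leq_add2l leq_mul2l (subset_leq_card (subsetDl _ _)) orbT.
move=> u uU; have := Umax (U :\ u); rewrite /f => /(_ _).
have -> : X :\: (U :\ u) = u |: (X :\: U).
  apply/setP => x; rewrite !inE; case: eqP => //= ->.
  by rewrite (subsetP UX).
rewrite cardsU1 !inE uU /=.
have -> : P :&: setX (U :\ u) (U :\ u) =
    (P :&: setX U U) :\: incident (P :&: setX U U) u.
  apply/setP => -[x y]; rewrite !inE /= .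
  by case: ((x, y) \in P); case: (x == u); case: (y == u); case: (x \in U); case: (y \in U).
have sub : incident (P :&: setX U U) u \subset P :&: setX U U.
  by apply/subsetP => p; rewrite inE => /andP[].
rewrite (cardsDS sub).
have := subset_leq_card sub.
have : U :\ u \subset X by apply: subset_trans UX; apply: subsetDl.
move=> h1 + /(_ h1). 
set a := #|_ :&: _|; set b := #|incident _ _|; set c := D * _; lia.
Qed.

(** If fewer than [N] ancestors lie just below the meeting point, pigeonhole keeps a class that
    meets one step lower, at the cost of a factor [N]. As [N ^ h < #|Q|], this stops before height
    0. *)
Lemma branching (T : finType) (par : T -> T) N h (Q : {set T}) : 0 < N ->
  {in Q &, forall u v, iter h par u = iter h par v} -> N ^ h < #|Q| ->
  exists h' (Q' : {set T}), [/\ 0 < h' <= h, Q' \subset Q,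
    #|Q| <= #|Q'| * N ^ (h - h'),
    {in Q' &, forall u v, iter h' par u = iter h' par v} &
    N <= #|iter h'.-1 par @: Q'|].
Proof.
move=> N0; elim: h Q => [|h IH] Q Qh.
  by rewrite ltnNge => /negP[]; apply/card_le1_eqP => u v uQ vQ; exact: Qh.
move=> NQ; case: (leqP N #|iter h par @: Q|) => [big|small].
  by exists h.+1, Q; rewrite subnn muln1; split => //; rewrite ltnS leqnn.
have [|c cQ] := @pigeonhole _ _ (iter h par) Q N _ (ltnW small).
  by apply: leq_ltn_trans NQ.
have [||h' [Q' [hh sub card com br]]] := IH [set x in Q | iter h par x == c].
- by move=> u v; rewrite !inE => /andP[_ /eqP->] /andP[_ /eqP->].
- by rewrite -(ltn_pmul2l N0) -expnS; apply: leq_trans NQ cQ.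
exists h', Q'; split => //; first lia.
  by apply: subset_trans sub _; apply/subsetP => x; rewrite inE => /andP[].
have -> : h.+1 - h' = (h - h').+1 by lia.
by apply: leq_trans cQ _; rewrite expnS mulnCA leq_mul2l card orbT.
Qed.

End Counting.

(** * From a dense pair of levels to a theta graph *)

Section DenseLevel.
Set Implicit Arguments. Unset Strict Implicit.
Variables (T : finType) (e : rel T) (l : nat) (k : 'I_l -> nat) (a1 : 'I_l) (kk : nat).
Hypothesis e_sym : symmetric e.
Hypothesis k_min : forall a, k a1 <= k a.
Hypothesis k1_gt0 : 0 < k a1.
Hypothesis k_pair : forall a, a != a1 -> 2 * kk <= k a1 + k a.
Hypothesis k_odd : forall a, odd (k a) = odd (k a1).

(** A budget for the greedy legs: [l] starting vertices, and legs of total length at most the sum of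
    the [k a]. *)
Definition theta_size := l + \sum_a k a.
Local Notation N := theta_size.

Variables (lev : nat -> {set T}) (par : T -> T) (i D : nat).
Hypothesis lev_inj : forall x j j', x \in lev j -> x \in lev j' -> j = j'.
Hypothesis par_lev : forall j x, j < i -> x \in lev j.+1 ->
  par x \in lev j /\ e x (par x).
Hypothesis lev0 : #|lev 0| <= 1.
Hypothesis degD : forall x, #|[set y | e x y]| <= D.
Hypothesis ik : 0 < i < kk.

(** Children are neighbours, so a tree vertex has at most [D] of them and each step up shrinks a set
    by at most the factor [D]. *)
Lemma card_iter_par j s (X : {set T}) : X \subset lev j -> s <= j <= i ->
  #|X| <= D ^ s * #|iter s par @: X|.
Proof.
move=> XL; elim: s => [|s IH] sj.
  by rewrite expn0 mul1n card_imset //; exact: inj_id.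
apply: leq_trans (IH _) _; first lia.
rewrite expnSr -mulnA leq_mul2l [D * _]mulnC; apply/orP; right.
have -> : iter s.+1 par @: X = par @: (iter s par @: X).
  by rewrite -imset_comp.
apply: card_fibers => c _.
apply: leq_trans (degD c); apply/subset_leq_card/subsetP => x.
rewrite !inE => /andP[/imsetP[z zX ->] /eqP<-]; rewrite e_sym.
by apply: (@iter_edge _ e lev par i par_lev z j s (subsetP XL _ zX)); lia.
Qed.

Lemma card_lev j : j <= i -> #|lev j| <= D ^ j.
Proof.
move=> ji; have := @card_iter_par j j (lev j) (subxx _); rewrite leqnn ji.
move=> /(_ isT) /leq_trans; apply; rewrite -[X in _ <= X]muln1 leq_mul2l.
apply/orP; right; apply: leq_trans lev0; apply/subset_leq_card/subsetP => x.
move=> /imsetP[y yj ->].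
by have := iter_lev par_lev (s := j) yj; rewrite leqnn ji subnn => /(_ isT).
Qed.

(** * Finding the theta graph below a fixed tree vertex *)

Section Finish.
Variables (h : nat) (y : T) (A B : {set T}).
Hypothesis hi : 0 < h <= i.
Let Q := [set v in lev i | iter h par v == y].
Hypothesis AQ : A \subset Q.
Hypothesis BW : B \subset lev i.+1.
Hypothesis degA : forall s, s \in A -> N <= #|[set w in B | e s w]|.
Hypothesis degB : forall s, s \in B -> N <= #|[set v in A | e s v]|.
Hypothesis branchB :
  forall s, s \in B -> N <= #|iter h.-1 par @: [set v in Q | e s v]|.

(** Covers both cases: if [h] is below the shortest length, [sp] is empty and [g = 0]; otherwise
    [sp] selects the shortest path, which is realised inside the tree. *)
Lemma theta_of_root g b (sp : pred 'I_l) (v : 'I_l -> T) (m : 'I_l -> nat) :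
  g < h -> b <> y ->
  (forall a, ~~ sp a -> v a \in (if odd (m a) then B else A)) ->
  (forall a, ~~ sp a -> k a = g + m a + h /\ 0 < m a) ->
  (forall a, ~~ sp a -> iter g par (v a) = b) ->
  (forall a, ~~ sp a -> v a \in lev i \/ g = 0 /\ sp =1 pred0) ->
  (0 < g -> forall a a', ~~ sp a -> ~~ sp a' -> a != a' ->
     iter g.-1 par (v a) <> iter g.-1 par (v a')) ->
  (forall a, sp a -> [/\ k a = h - g, iter (h - g) par b = y & b \in lev (i - g)]) ->
  (forall a a', sp a -> sp a' -> a = a') ->
  contains_subgraph e (theta_adj k).
Proof.
move=> gh bney vAB kE vb vi gv spP sp1.
pose c := [seq a <- enum 'I_l | ~~ sp a].
have cE a : (a \in c) = ~~ sp a by rewrite mem_filter mem_enum andbT.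
(* With the starting vertices forbidden, legs avoid them and end in branches different from
   theirs. *)
have [||||r [rP rd]] := @linkage T e (iter h.-1 par) A B Q N degA degB branchB
    'I_l c v m (v @: setT).
- by rewrite filter_uniq // enum_uniq.
- by move=> a; rewrite cE => /kE[].
- by move=> a; rewrite cE => /vAB.
- apply: leq_add.
    by apply: leq_trans (leq_imset_card _ _) _; rewrite cardsT card_ord.
  rewrite big_filter big_enum_cond /= [X in _ <= X](bigID sp) /=.
  apply: leq_trans (leq_addl _ _); apply: leq_sum => a /kE[-> _]; lia.
have Qi x : x \in Q -> x \in lev i by rewrite inE => /andP[].
have rnl a x j : ~~ sp a -> x \in r a -> j < i -> x \notin lev j.
  rewrite -cE => /rP[_ _ _ rZ _] /rZ[_]; rewrite !in_setU -orbA => xin ji.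
  apply/negP => xj; case/or3P: xin.
  - by move=> /(subsetP AQ) /Qi /(lev_inj xj); lia.
  - by move=> /(subsetP BW) /(lev_inj xj); lia.
  - by move=> /Qi /(lev_inj xj); lia.
apply: (@theta_of_linkage T e lev par i e_sym lev_inj par_lev l k g h b y sp v r);
  rewrite ?gh //.
- lia.
- by move=> a sa; have := sa; rewrite -cE => /rP[-> -> -> _ _]; case: (kE a sa).
- move=> a; rewrite -cE => /rP[_ _ _ _ [+ _]].
  by rewrite inE => /andP[_ /eqP].
- by move=> a; rewrite -cE => /rP[_ _ _ _ [/Qi]].
- move=> a a' sa; rewrite -cE => /rP[_ _ _ rZ _]; apply/negP => /rZ[].
  by rewrite imset_f // inE.
- move=> a a'; rewrite -cE => /rP[_ _ _ _ [_ /negP rb]] sa' E; apply: rb.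
  by rewrite E imset_f // imset_f // inE.
- by move=> a a'; rewrite -!cE => ac ac' aa'; exact: rd.
- move=> a sa; case: (vi _ sa) => [|[g0 sp0]]; [by left|right; split=> // j ji].
  apply/negP => vj; have := vAB _ sa; case: ifP => _.
    by move=> /(subsetP BW) /(lev_inj vj); lia.
  by move=> /(subsetP AQ) /Qi /(lev_inj vj); lia.
Qed.

End Finish.

(* Each [w] in the level below gets a height [hh w] and a set [QQ w] of
   neighbours that meet at that height and branch widely just below it. *)
Lemma branch_choice : exists (hh : T -> 'I_kk) (QQ : T -> {set T}), forall w,
  [/\ 0 < hh w <= i, QQ w \subset [set v in lev i | e v w],
      #|[set v in lev i | e v w]| <= N ^ i * #|QQ w| + N ^ i,
      {in QQ w &, forall u v, iter (hh w) par u = iter (hh w) par v} &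
      QQ w = set0 \/ N <= #|iter (hh w).-1 par @: QQ w|].
Proof.
have N0 : 0 < N by rewrite /N; have := ltn_ord a1; lia.
pose P w (z : 'I_kk * {set T}) := [/\ 0 < z.1 <= i, z.2 \subset [set v in lev i | e v w],
      #|[set v in lev i | e v w]| <= N ^ i * #|z.2| + N ^ i,
      {in z.2 &, forall u v, iter z.1 par u = iter z.1 par v} &
      z.2 = set0 \/ N <= #|iter z.1.-1 par @: z.2|].
have [f fP] : exists f : T -> 'I_kk * {set T}, forall w, P w (f w).
  apply: (@fin_all_exists T (fun=> 'I_kk * {set T})%type P) => w.
  set Nw := [set v in lev i | e v w]; have k1 : 1 < kk by lia.
  (* Up to [N ^ i] neighbours are paid for by the additive term, with the empty set chosen.
     Otherwise branching starts from the root, the common ancestor at height [i]. *)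
  case: (leqP #|Nw| (N ^ i)) => [small|big].
    exists (Ordinal k1, set0); split => //=; rewrite ?sub0set ?cards0 ?muln0 //; first lia.
      by move=> u v; rewrite inE.
    by left.
  have [|h [Q' [hi Qsub Qc com br]]] := @branching T par N i Nw N0 _ big.
    move=> u v; rewrite !inE => /andP[ui _] /andP[vi _].
    have /card_le1_eqP := lev0; apply.
      by have := iter_lev par_lev (s := i) vi; rewrite leqnn subnn => /(_ isT).
    by have := iter_lev par_lev (s := i) ui; rewrite leqnn subnn => /(_ isT).
  have hk : h < kk by lia.
  exists (Ordinal hk, Q'); split => //=; last by right.
  apply: leq_trans Qc _; apply: leq_trans (leq_addr _ _).
  by rewrite mulnC leq_mul2r leq_pexp2l ?orbT //; lia.
exists (fun w => (f w).1), (fun w => (f w).2) => w; exact: (fP w).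
Qed.

(** Factors of the constant: a 2 for the vertices with few neighbours, [N ^ kk] for passing to
    branching neighbourhoods, [kk] for a common height, a 2 for pruning, and a last [N] that pays
    for pruning to degree [N] and for finding [b]. *)
Lemma theta_of_dense_level (F := [set p | [&& p.1 \in lev i, p.2 \in lev i.+1 & e p.1 p.2]]) :
  4 * kk * N ^ kk * N * (#|lev i| + #|lev i.+1|) <= #|F| ->
  4 * kk * N ^ kk * N * D ^ i < #|F| ->
  contains_subgraph e (theta_adj k).
Proof.
move=> F1 F2; have [hh [QQ QP]] := branch_choice.
have N0 : 0 < N by rewrite /N; have := ltn_ord a1; lia.
pose G := [set p | (p.2 \in lev i.+1) && (p.1 \in QQ p.2)].
have FG : #|F| <= N ^ i * #|G| + N ^ i * #|lev i.+1|.
  rewrite (card_pairs_snd F) (card_pairs_snd G).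
  rewrite big_distrr /= -[#|lev i.+1|]sum1_card big_distrr /= [X in _ + X]big_mkcond.
  rewrite -big_split /=; apply: leq_sum => w _; case: ifP => wi; last first.
    have -> : [set v | (v, w) \in F] = set0.
      by apply/setP => v; rewrite !inE /= wi andbF.
    by rewrite cards0.
  have [_ _ + _ _] := QP w; rewrite muln1; congr (_ <= _ * _ + _).
    by apply: eq_card => v; rewrite !inE /= wi.
  by apply: eq_card => v; rewrite !inE /= wi.
have Nik : N ^ i <= N ^ kk by rewrite leq_pexp2l //; lia.
have F2N : 2 * (N ^ i * #|lev i.+1|) <= #|F|.
  apply: leq_trans F1; rewrite mulnA; apply: leq_mul; last exact: leq_addl.
  have -> : 4 * kk * N ^ kk * N = 2 * N ^ kk * (2 * kk * N) by lia.
  apply: (@leq_trans (2 * N ^ kk)); first by rewrite leq_mul2l Nik.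
  by apply: leq_pmulr; rewrite !muln_gt0 N0; lia.
have G0 : 0 < #|G|.
  by rewrite lt0n; apply/negP => /eqP G0; move: FG; rewrite G0 muln0; lia.
have [h0 Gh] : exists h0, #|G| <= kk * #|[set p in G | hh p.2 == h0]|.
  by apply: pigeonhole => //; apply: leq_trans (max_card _) _; rewrite card_ord.
set Gh0 := [set p in G | _] in Gh.
have Fh : #|F| <= 2 * kk * N ^ i * #|Gh0|.
  have : N ^ i * #|G| <= N ^ i * (kk * #|Gh0|) by rewrite leq_mul2l Gh orbT.
  lia.
have GhN : 2 * (N * #|lev i :|: lev i.+1|) <= #|Gh0|.
  have c0 : 0 < 2 * kk * N ^ i by rewrite !muln_gt0 expn_gt0 N0; lia.
  rewrite -(leq_pmul2l c0); apply: leq_trans Fh; apply: leq_trans F1.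
  set U := #|_ :|: _|; have -> : 2 * kk * N ^ i * (2 * (N * U)) = 4 * kk * N ^ i * N * U by lia.
  apply: leq_mul; last exact: leq_card_setU.
  by rewrite leq_mul2r leq_mul2l Nik !orbT.
have [|U [UX GU Udeg]] := @prune _ Gh0 (lev i :|: lev i.+1) N.
  apply/subsetP => -[v w]; rewrite !inE /= => /andP[/andP[wi vQ] _].
  rewrite wi orbT andbT; have [_ /subsetP/(_ _ vQ)] := QP w.
  by rewrite inE => /andP[->].
set PU := Gh0 :&: setX U U in GU Udeg.
have PUE v w : ((v, w) \in PU) = [&& v \in U, w \in U, w \in lev i.+1, v \in QQ w & hh w == h0].
  by rewrite !inE /=; case: (v \in U); case: (w \in U); rewrite /= ?andbF ?andbT ?andbA.
have QQe w v : v \in QQ w -> v \in lev i /\ e v w.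
  by have [_ /subsetP sub _ _ _] := QP w => /sub; rewrite inE => /andP[].
have degL v : v \in U -> v \in lev i -> N <= #|[set w | (v, w) \in PU]|.
  move=> vU vi; apply: leq_trans (Udeg _ vU) _.
  apply: leq_trans (leq_imset_card (fun w => (v, w)) _).
  apply/subset_leq_card/subsetP => -[v' w']; rewrite inE => /andP[pP] /orP[] /= /eqP E.
    by rewrite -E; apply/imsetP; exists w'; rewrite // in_set.
  move: pP; rewrite PUE E => /and4P[_ _ vi' _].
  by have := lev_inj vi vi'; lia.
have degW w : w \in U -> w \in lev i.+1 -> N <= #|[set v | (v, w) \in PU]|.
  move=> wU wi; apply: leq_trans (Udeg _ wU) _.
  apply: leq_trans (leq_imset_card (fun v => (v, w)) _).
  apply/subset_leq_card/subsetP => -[v' w']; rewrite inE => /andP[pP] /orP[] /= /eqP E; last first.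
    by rewrite -E; apply/imsetP; exists v'; rewrite // in_set.
  move: pP; rewrite PUE E => /and5P[_ _ _ /QQe[wi' _] _].
  by have := lev_inj wi wi'; lia.
have PUbig : N * D ^ i < #|PU|.
  have c0 : 0 < 4 * kk * N ^ i by rewrite !muln_gt0 expn_gt0 N0; lia.
  have FP : #|F| <= 4 * kk * N ^ i * #|PU|.
    have -> : 4 * kk * N ^ i * #|PU| = 2 * kk * N ^ i * (2 * #|PU|) by lia.
    apply: leq_trans Fh _; rewrite leq_mul2l; apply/orP; right.
    have aux a b c : a <= b + c -> 2 * c <= a -> a <= 2 * b by lia.
    exact: aux GU GhN.
  rewrite -(ltn_pmul2l c0); apply: leq_trans FP; apply: leq_ltn_trans F2.
  rewrite mulnA leq_mul2r; apply/orP; right.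
  by rewrite leq_mul2r leq_mul2l Nik !orbT.
have hi : 0 < h0 <= i.
  have /card_gt0P[[v w]] : 0 < #|PU| by lia.
  by rewrite PUE => /and5P[_ _ _ _ /eqP <-]; case: (QP w).
(* Pairs of [PU] never join different roots [y], so degrees survive the restriction to one root.
   [Q y] is not cut down to [U], because pruning may destroy branching: only the end of a leg may
   leave [U]. *)
pose A y := [set v in U :&: lev i | iter h0 par v == y].
pose B y := [set w in U :&: lev i.+1 | [forall v in QQ w, iter h0 par v == y]].
pose Q y := [set v in lev i | iter h0 par v == y].
have AQ y : A y \subset Q y.
  by apply/subsetP => v; rewrite !inE => /andP[/andP[_ ->] ->].
have BW y : B y \subset lev i.+1.
  by apply/subsetP => v; rewrite !inE => /andP[/andP[_ ->] _].
have rootB v w y : (v, w) \in PU -> iter h0 par v = y -> w \in B y.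
  rewrite PUE !inE => /and5P[_ -> -> vQ /eqP hw] vy /=; apply/forall_inP => v' v'Q.
  by have [_ _ _ com _] := QP w; rewrite -vy -hw; apply/eqP; exact: com.
have degA y s : s \in A y -> N <= #|[set w in B y | e s w]|.
  rewrite !inE => /andP[/andP[sU si] /eqP sy]; apply: leq_trans (degL _ sU si) _.
  apply/subset_leq_card/subsetP => w; rewrite inE => p; rewrite inE (rootB _ _ _ p sy).
  by move: p; rewrite PUE => /and5P[_ _ _ /QQe[_ ->]].
have degB y s : s \in B y -> N <= #|[set v in A y | e s v]|.
  rewrite !inE => /andP[/andP[sU si] /forall_inP sy]; apply: leq_trans (degW _ sU si) _.
  apply/subset_leq_card/subsetP => v; rewrite inE PUE !inE.
  move=> /and5P[-> _ _ vQ _]; rewrite sy //; have [-> ev] := QQe _ _ vQ.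
  by rewrite e_sym ev.
have brB y s : s \in B y -> N <= #|iter h0.-1 par @: [set v in Q y | e s v]|.
  rewrite !inE => /andP[/andP[sU si] /forall_inP sy].
  have /card_gt0P[v] : 0 < #|[set v | (v, s) \in PU]| by apply: leq_trans (degW _ sU si).
  rewrite inE PUE => /and5P[_ _ _ vQ /eqP hs].
  have [_ _ _ _] := QP s; rewrite hs => -[Q0|]; first by move: vQ; rewrite Q0 inE.
  move=> /leq_trans; apply; apply/subset_leq_card/imsetS/subsetP => u uQ.
  by rewrite !inE sy //; have [-> eu] := QQe _ _ uQ; rewrite e_sym eu.
case: (ltnP h0 (k a1)) => hk.
  have /card_gt0P[[v w] pP] : 0 < #|PU| by lia.
  have := pP; rewrite PUE => /and5P[vU wU wi /QQe[vi evw] hw].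
  (* All leg lengths [k a - h0] have the same parity, so one start [b] on the right side serves
     every leg. *)
  pose b := if odd (k a1 - h0) then w else v.
  have nl j : j < i -> b \notin lev j.
    move=> ji; apply/negP; rewrite /b; case: ifP => _ bj.
      by have := lev_inj wi bj; lia.
    by have := lev_inj vi bj; lia.
  pose y := iter h0 par v.
  apply: (@theta_of_root h0 y (A y) (B y) hi (AQ y) (BW y) (degA y) (degB y) (brB y)
    0 b pred0 (fun=> b) (fun a => k a - h0)) => //.
  - lia.
  - move=> E; have /negP[] : b \notin lev (i - h0) by apply: nl; lia.
    by rewrite E; apply: (iter_lev par_lev vi); lia.
  - move=> a _; have ka := k_min a.
    rewrite oddB; last lia.
    rewrite k_odd -oddB; last lia.
    rewrite /b; case: ifP => _; first exact: rootB pP erefl.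
    by rewrite !inE vU vi eqxx.
  - by move=> a _; have ka := k_min a; lia.
  - by move=> a _; right.
(* [b] is to lie [g] steps above the starts of the legs and [k a1] steps below [y]. For positive [g]
   the starts must lie below distinct children of [b]. *)
pose g := h0 - k a1.
have [b [v [vA vb vg]]] : exists b (v : 'I_l -> T),
    [/\ forall a, v a \in U :&: lev i, forall a, iter g par (v a) = b &
     0 < g -> forall a a', a != a' -> iter g.-1 par (v a) <> iter g.-1 par (v a')].
  case: (posnP g) => g0.
    have /card_gt0P[[v w] pP] : 0 < #|PU| by lia.
    move: pP; rewrite PUE => /and5P[vU wU wi /QQe[vi evw] hw].
    exists v, (fun=> v); rewrite g0; split => // a.
    by rewrite inE vU vi.
  pose C := iter g.-1 par @: (U :&: lev i).
  have [b bC] : exists b, l <= #|[set x in C | par x == b]|.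
    (* If every vertex had fewer than [l] children in [C], then [U :&: lev i] would have at most
       [l * D ^ (i - 1)] vertices and [PU] at most [l * D ^ i] pairs, against [PUbig]. *)
    apply/existsP; rewrite -[[exists _, _]]negbK negb_exists; apply/negP => /forallP small.
    have Cs : #|C| <= #|par @: C| * l.
      by apply: card_fibers => c _; have := small c; rewrite -ltnNge; lia.
    have Cl : #|par @: C| <= D ^ (i - g).
      apply: leq_trans (card_lev (leq_subr _ _)).
      apply/subset_leq_card/subsetP => _ /imsetP[_ /imsetP[x xA ->] ->].
      have xi : x \in lev i by move: xA; rewrite inE => /andP[].
      have -> : par (iter g.-1 par x) = iter g par x by rewrite -iterS prednK.
      by apply: (iter_lev par_lev xi); lia.
    have := @card_iter_par i g.-1 (U :&: lev i) (subsetIr _ _).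
    have gi : g.-1 <= i <= i by lia.
    rewrite -/C => /(_ gi) UC.
    have PUD : #|PU| <= #|U :&: lev i| * D.
      rewrite (card_pairs_fst PU); apply: leq_sum_const => x xA.
        apply: leq_trans (degD x); apply/subset_leq_card/subsetP => w.
        by rewrite inE PUE inE => /and5P[_ _ _ /QQe[]].
      apply/eqP; rewrite cards_eq0; apply/eqP/setP => w; rewrite inE PUE [RHS]inE.
      apply/negP => /and5P[xU _ _ /QQe[xi _] _].
      by move: xA; rewrite inE xU xi.
    have lN : l <= N by rewrite leq_addr.
    have : #|PU| <= l * D ^ i.
      apply: leq_trans PUD _.
      have -> : D ^ i = D ^ g.-1 * D ^ (i - g) * D.
        by rewrite -expnD -expnSr; congr (D ^ _); lia.
      rewrite mulnA leq_mul2r; apply/orP; right.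
      apply: leq_trans UC _; rewrite mulnCA leq_mul2l; apply/orP; right.
      by apply: leq_trans Cs _; rewrite mulnC leq_mul2l Cl orbT.
    by have : l * D ^ i <= N * D ^ i by [rewrite leq_mul2r lN orbT]; lia.
  have /fin_all_exists[v vP] : forall a : 'I_l, exists v,
      v \in U :&: lev i /\ iter g.-1 par v = enum_val (widen_ord bC a).
    move=> a; have := enum_valP (widen_ord bC a).
    by rewrite inE => /andP[/imsetP[x xA ->] _]; exists x.
  exists b, v; split.
  - by move=> a; case: (vP a).
  - move=> a; have := enum_valP (widen_ord bC a).
    rewrite inE => /andP[_ /eqP <-]; have [_ <-] := vP a.
    by rewrite -iterS prednK.
  - move=> _ a a' /eqP aa'; have [_ ->] := vP a; have [_ ->] := vP a'.
    by move=> /enum_val_inj /(congr1 val) /= /val_inj.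
pose y := iter (k a1) par b.
have vi a : v a \in lev i by have := vA a; rewrite inE => /andP[].
have bi : b \in lev (i - g).
  by rewrite -(vb a1); apply: (iter_lev par_lev (vi _)); lia.
have hg : h0 - g = k a1 by rewrite /g; lia.
(* The leg lengths are even, so legs start in [A y]; they are positive because
   [2 * kk <= k a + k a1] and [h0 <= i < kk]. *)
apply: (@theta_of_root h0 y (A y) (B y) hi (AQ y) (BW y) (degA y) (degB y) (brB y)
    g b (pred1 a1) v (fun a => k a + k a1 - 2 * h0)) => //.
- rewrite /g; lia.
- move=> E; have : b \in lev (i - h0).
    have -> : i - h0 = i - g - k a1 by rewrite /g; lia.
    by rewrite {1}E; apply: (iter_lev par_lev bi); rewrite /g; lia.
  by move=> /(lev_inj bi); rewrite /g; lia.
- move=> a /= aa1; have := k_pair aa1 => kp.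
  rewrite oddB; last lia.
  rewrite oddD k_odd addbb oddM /=.
  rewrite inE vA /y -(vb a) -iterD; apply/eqP; congr (iter _ par _).
  by rewrite /g; lia.
- by move=> a /= aa1; have := k_pair aa1 => kp; rewrite /g; lia.
- by left.
- by move=> g0 a a' _ _; exact: vg.
- by move=> a /= /eqP ->; rewrite hg.
- by move=> a a' /= /eqP -> /eqP ->.
Qed.

End DenseLevel.

(** * Breadth-first levels of a bipartite graph *)

Section Levels.
Set Implicit Arguments. Unset Strict Implicit.
Variables (T : finType) (e : rel T) (x0 : T) (A : {set T}).
Hypothesis e_sym : symmetric e.
Hypothesis e_cut : forall x y, e x y -> (x \in A) != (y \in A).

Definition ball j : {set T} :=
  iter j (fun S : {set T} => S :|: [set y | [exists x in S, e x y]]) [set x0].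

Definition level j : {set T} :=
  if j is j'.+1 then ball j :\: ball j' else ball 0.

Lemma ballS j y : (y \in ball j.+1) = (y \in ball j) || [exists x in ball j, e x y].
Proof. by rewrite [ball _]iterS !inE. Qed.

Lemma ball_mono j j' : j <= j' -> ball j \subset ball j'.
Proof.
move=> /subnK <-; elim: (j' - j) => // m IH.
by apply: subset_trans IH _; apply/subsetP => y; rewrite addSn ballS => ->.
Qed.

Lemma level_ball j : level j \subset ball j.
Proof. by case: j => // j; apply: subsetDl. Qed.

Lemma level_inj x j j' : x \in level j -> x \in level j' -> j = j'.
Proof.
suff lt m m' : x \in level m -> x \in level m' -> m' <= m.
  by move=> xj xj'; apply/eqP; rewrite eqn_leq !lt.
move=> xm; case: m' => // m'; rewrite inE => /andP[xm' _].
rewrite ltnNge; apply: contraNN xm' => mm.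
exact: (subsetP (ball_mono mm)) _ (subsetP (level_ball m) _ xm).
Qed.

Lemma ball_level x m : x \in ball m -> exists2 j, j <= m & x \in level j.
Proof.
elim: m => [|m IH]; first by exists 0.
move=> xm; case: (boolP (x \in ball m)) => [/IH[j jm xj]|xnm].
  by exists j => //; apply: leqW.
by exists m.+1; rewrite // inE xnm.
Qed.

Lemma level_pred x j : x \in level j.+1 -> exists2 y, y \in level j & e x y.
Proof.
rewrite inE ballS => /andP[xj]; rewrite (negbTE xj) /= => /exists_inP[y yj yx].
exists y; last by rewrite e_sym.
case: j xj yj => // j xj yj; rewrite inE yj andbT.
apply: contraNN xj => yj'; rewrite ballS; apply/orP; right.
by apply/exists_inP; exists y.
Qed.

Lemma level0 : level 0 = [set x0]. Proof. by []. Qed.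

(* Otherwise [inE] unfolds membership in [level j.+1]. *)
Opaque level.

Lemma level_parity x j : x \in level j -> (x \in A) = (x0 \in A) (+) odd j.
Proof.
elim: j x => [|j IH] x; first by rewrite level0 inE addbF => /eqP ->.
move=> /level_pred[y /IH yA /e_cut]; rewrite yA /=.
by case: (x \in A); case: (x0 \in A); case: (odd j).
Qed.

(** Distances of adjacent vertices from [x0] differ by at most one, and parity excludes equality. *)
Lemma level_nbr x y j : x \in level j -> e x y ->
  y \in level j.+1 \/ 0 < j /\ y \in level j.-1.
Proof.
move=> xj xy; have /ball_level[m mj ym] : y \in ball j.+1.
  rewrite ballS; apply/orP; right; apply/exists_inP; exists x => //.
  exact: (subsetP (level_ball j)).
have /ball_level[m' mj' xm'] : x \in ball m.+1.
  rewrite ballS; apply/orP; right; apply/exists_inP; exists y; last by rewrite e_sym.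
  exact: (subsetP (level_ball m)).
have jm : j <= m.+1 by rewrite (level_inj xj xm').
have : m != j.
  apply: contraTneq (e_cut xy) => mE.
  by rewrite (level_parity xj) (level_parity ym) mE eqxx.
move=> mnj; have [mE|[j0 mE]] : m = j.+1 \/ (0 < j /\ m = j.-1) by lia.
  by left; rewrite -mE.
by right; rewrite -mE.
Qed.

Definition level_edges j :=
  [set p | [&& p.1 \in level j, p.2 \in level j.+1 & e p.1 p.2]].

Lemma level_degree d j : (forall x, x \in level j.+1 -> d <= #|[set y | e x y]|) ->
  d * #|level j.+1| <= #|level_edges j| + #|level_edges j.+1|.
Proof.
move=> deg; rewrite (card_pairs_snd (level_edges j)) (card_pairs_fst (level_edges j.+1)).
rewrite -big_split /= mulnC -sum_nat_const.
rewrite [X in _ <= X](bigID (mem (level j.+1))) /=.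
apply: leq_trans (leq_addr _ _); apply: leq_sum => x xj.
apply: leq_trans (deg x xj) _; apply: leq_trans (leq_card_setU _ _).
apply/subset_leq_card/subsetP => y; rewrite !inE /= => xy.
have /orP : (y \in level j.+2) \/ (y \in level j).
  by case: (level_nbr xj xy) => [|[_]] /= ?; [left|right].
case/orP => yj; apply/orP; [right|left].
  by move: xj yj; rewrite !inE /= xy => -> ->.
by move: xj yj; rewrite !inE /= (e_sym y) xy => -> ->.
Qed.

(** The bound [n] makes the search over levels finite; the default [x] is returned only outside
    levels 1 to [n]. *)
Definition parent n x := odflt x
  [pick y | e x y && [exists j : 'I_n, (x \in level j.+1) && (y \in level j)]].

Lemma parentP n j x : j < n -> x \in level j.+1 ->
  parent n x \in level j /\ e x (parent n x).
Proof.
move=> jn xj; rewrite /parent; case: pickP => [y /andP[xy /existsP[j' /andP[xj' yj']]]|].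
  by have [<-] := level_inj xj' xj.
have [y yj xy] := level_pred xj => /(_ y) /=; rewrite xy /= => /existsP[].
by exists (Ordinal jn); rewrite /= xj yj.
Qed.

End Levels.

(** * Growth of the levels in a theta-free graph *)

Section Growth.
Set Implicit Arguments. Unset Strict Implicit.
Variables (T : finType) (e : rel T) (l : nat) (k : 'I_l -> nat) (a1 : 'I_l) (kk : nat).
Hypothesis e_sym : symmetric e.
Hypothesis k_min : forall a, k a1 <= k a.
Hypothesis k1_gt0 : 0 < k a1.
Hypothesis k_pair : forall a, a != a1 -> 2 * kk <= k a1 + k a.
Hypothesis k_odd : forall a, odd (k a) = odd (k a1).
Hypothesis kk_gt0 : 0 < kk.

Local Notation N := (theta_size k).
Definition density_const := 4 * kk * N ^ kk * N.
Local Notation c := density_const.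

(** Each level outgrows the previous one by a factor [d / (4 * c)], and level [kk] lies in [U]. The
    lower bound on [d] secures the second requirement of [theta_of_dense_level], more than
    [c * (K * d) ^ j] edges. *)
Lemma growth (A U : {set T}) (d K : nat) :
  (forall x y, e x y -> (x \in A) != (y \in A)) ->
  (forall x y, e x y -> x \in U) -> U != set0 ->
  (forall x, x \in U -> d <= #|[set y | e x y]|) ->
  (forall x, #|[set y | e x y]| <= K * d) ->
  2 * c * (K * (4 * c)) ^ kk < d -> 0 < K ->
  ~ contains_subgraph e (theta_adj k) ->
  d ^ kk <= (4 * c) ^ kk * #|U|.
Proof.
move=> cut eU /set0Pn[x0 x0U] dmin dmax dbig K0 noT.
pose lev := level e x0; pose par := parent e x0 kk.
pose a j := #|lev j|; pose f j := #|level_edges e x0 j|.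
have N0 : 0 < N by rewrite /theta_size; have := ltn_ord a1; lia.
have c0 : 0 < c by rewrite /density_const !muln_gt0 expn_gt0 N0; lia.
have levU j : lev j \subset U.
  apply/subsetP => x; case: j => [|j]; first by rewrite /lev level0 inE => /eqP ->.
  by move=> /(level_pred e_sym)[y _ /eU].
have c4d : 4 * c <= d.
  apply: leq_trans (ltnW dbig); have := leq_pmull (4 * c) K0; move: (K * (4 * c)) => z cz.
  apply: leq_trans cz _; apply: leq_trans (leq_pmull _ _); last by lia.
  by case: (posnP z) => [->//|z0]; rewrite -{1}[z]expn1 leq_pexp2l.
have deg1 : d <= a 1.
  apply: leq_trans (dmin _ x0U) _; apply/subset_leq_card/subsetP => y; rewrite inE => xy.
  have x00 : x0 \in level e x0 0 by rewrite level0 inE.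
  by case: (level_nbr e_sym cut x00 xy) => [//|[]].
have f0 : f 0 <= a 1.
  rewrite /f (card_pairs_fst (level_edges e x0 0)).
  have -> : a 1 = #|level e x0 0| * a 1 by rewrite level0 cards1 mul1n.
  apply: leq_sum_const => v vx.
    by apply/subset_leq_card/subsetP => w; rewrite 2!in_set => /and3P[].
  apply/eqP; rewrite cards_eq0; apply/eqP/setP => w; rewrite [RHS]inE 2!in_set.
  by apply/negP => /and3P[vx1 _ _]; rewrite vx1 in vx.
have dense j : 0 < j < kk -> c * (K * d) ^ j < f j -> f j < c * (a j + a j.+1).
  move=> jk fj; rewrite ltnNge; apply/negP => fj'; apply: noT.
  apply: (@theta_of_dense_level T e l k a1 kk e_sym k_min k1_gt0 k_pair k_odd
     lev par j (K * d)) => //.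
  - by move=> x m m'; exact: level_inj.
  - by move=> m x mj; apply: parentP => //; lia.
  - by rewrite /lev level0 cards1.
suff main j : j < kk -> [/\ d * a j <= 4 * c * a j.+1,
    d ^ j.+1 <= (4 * c) ^ j.+1 * a j.+1 & f j <= c * (a j + a j.+1)].
  have [|_ + _] := main kk.-1; first lia.
  rewrite prednK // => /leq_trans; apply.
  by rewrite leq_mul2l (subset_leq_card (levU _)) orbT.
elim: j => [|j IH] jk.
  have a0 : a 0 = 1 by rewrite /a /lev level0 cards1.
  rewrite a0 !expn1 muln1; split; [nia|nia|].
  by apply: leq_trans f0 _; nia.
have [|IH1 IH2 IH3] := IH; first lia.
have deg : d * a j.+1 <= f j + f j.+1.
  by apply: (level_degree e_sym cut) => x /(subsetP (levU _)); exact: dmin.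
have ajj : a j <= a j.+1.
  rewrite -(@leq_pmul2l d); last lia.
  by apply: leq_trans IH1 _; rewrite leq_mul2r c4d orbT.
(* By [IH3], [ajj] and [4 * c <= d], at most half of the degree sum goes back to level [j]. *)
have f2 : d * a j.+1 <= 2 * f j.+1 by nia.
(* [IH2] bounds [a j.+1] below by a power of [d / (4 * c)]; the extra factor [d] in [f2] absorbs the
   constants through [dbig]. *)
have fbig : c * (K * d) ^ j.+1 < f j.+1.
  set E := 4 * c in IH2 dbig *; have E0 : 0 < E ^ j.+1 by rewrite expn_gt0 /E; lia.
  have dj0 : 0 < d ^ j.+1 by rewrite expn_gt0; lia.
  rewrite -(ltn_pmul2l E0).
  have h1 : d * d ^ j.+1 <= 2 * (E ^ j.+1 * f j.+1).
    apply: (@leq_trans (E ^ j.+1 * (d * a j.+1))).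
      by rewrite [E ^ _ * _]mulnCA leq_mul2l IH2 orbT.
    by rewrite [X in _ <= X]mulnCA leq_mul2l f2 orbT.
  have h2 : 2 * c * (K * E) ^ j.+1 < d.
    have KE0 : 0 < K * E by rewrite muln_gt0 K0 /E; lia.
    by apply: leq_ltn_trans dbig; rewrite leq_mul2l leq_pexp2l ?orbT //; lia.
  have h3 : 2 * c * (K * E) ^ j.+1 * d ^ j.+1 < d * d ^ j.+1 by rewrite ltn_pmul2r.
  suff : 2 * (E ^ j.+1 * (c * (K * d) ^ j.+1)) < 2 * (E ^ j.+1 * f j.+1) by lia.
  apply: leq_trans h1; move: h3; congr (_ < _); rewrite !expnMn; nia.
have fsmall := dense j.+1 jk fbig.
have g1 : d * a j.+1 <= 4 * c * a j.+2 by nia.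
split=> //; last exact: ltnW.
rewrite expnSr [(4 * c) ^ j.+2]expnSr -mulnA.
apply: (@leq_trans ((4 * c) ^ j.+1 * (d * a j.+1))); last by rewrite leq_mul2l g1 orbT.
by rewrite mulnCA [d * _]mulnC leq_mul2r IH2 orbT.
Qed.

End Growth.

(** * Passing to an almost regular bipartite subgraph *)

Section Regularization.
Set Implicit Arguments. Unset Strict Implicit.

(** Discarding an element of smallest value never lowers the average. *)
Lemma large_average_subset (T : finType) (f : T -> nat) q (S : {set T}) :
  q <= #|S| -> exists P : {set T}, [/\ P \subset S, #|P| = q &
    q * \sum_(x in S) f x <= #|S| * \sum_(x in P) f x].
Proof.
move: {2}(#|S| - q) (erefl (#|S| - q)) => n; elim: n S => [|n IH] S nE qS.
  have {}nE : #|S| = q by lia.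
  by exists S; rewrite nE.
case: (posnP q) => [->|q0].
  by exists set0; rewrite sub0set cards0.
have /card_gt0P[x0 x0S] : 0 < #|S| by lia.
case: (arg_minnP f x0S) => v vS vmin; have {}vS : v \in S by [].
have Sv := cardsD1 v S; rewrite vS /= in Sv.
have [||P [PS PqE Psum]] := IH (S :\ v); [lia|lia|].
exists P; split => //; first by apply: subset_trans PS (subsetDl _ _).
have sS : \sum_(x in S) f x = f v + \sum_(x in S :\ v) f x by rewrite (big_setD1 v).
have vS' : #|S :\ v| * f v <= \sum_(x in S :\ v) f x.
  rewrite -sum_nat_const; apply: leq_sum => x; rewrite inE => /andP[_]; exact: vmin.
rewrite sS Sv; move: vS' Psum; set s := \sum_(x in S :\ v) f x; set p := \sum_(x in P) f x.
have : 0 < #|S :\ v| by lia.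
move: (#|S :\ v|) => m m0 h1 h2.
rewrite -(leq_pmul2l m0).
have h3 : m * (q * (f v + s)) <= (1 + m) * (q * s).
  have : q * (m * f v) <= q * s by rewrite leq_mul2l h1 orbT.
  lia.
apply: leq_trans h3 _.
have : (1 + m) * (q * s) <= (1 + m) * (m * p) by rewrite leq_mul2l h2 orbT.
lia.
Qed.

(** Moving [x] across a maximum cut gains nothing, and each edge at [x] crosses either before or
    after the move. *)
Lemma max_cut (T : finType) (e : rel T) : symmetric e -> irreflexive e ->
  exists A : {set T}, forall x,
    #|[set y | e x y]| <= 2 * #|[set y | e x y && ((x \in A) != (y \in A))]|.
Proof.
move=> e_sym e_irr.
pose w (A : {set T}) x y : nat := e x y && ((x \in A) != (y \in A)).
pose g A := \sum_x \sum_y w A x y.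
case: (@arg_maxnP _ set0 predT g isT) => A _ Amax.
exists A => x; pose A' := [set y | (y \in A) (+) (y == x)].
have wE B y : w B y x = w B x y by rewrite /w e_sym eq_sym.
have gE B : g B = 2 * (\sum_(y | y != x) w B x y) +
    \sum_(y | y != x) \sum_(z | z != x) w B y z.
  rewrite /g (bigD1 x) //= (bigD1 x) //= {1}/w e_irr /= add0n.
  rewrite [X in _ + X](eq_bigr (fun y => w B x y + \sum_(z | z != x) w B y z)); last first.
    by move=> y yx; rewrite (bigD1 x) //= wE.
  by rewrite big_split /= mul2n -addnn addnA.
have := Amax A' isT; rewrite /geq /= !gE.
have -> : \sum_(y | y != x) \sum_(z | z != x) w A' y z =
    \sum_(y | y != x) \sum_(z | z != x) w A y z.
  apply: eq_bigr => y yx; apply: eq_bigr => z zx.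
  by rewrite /w !inE (negbTE yx) (negbTE zx) !addbF.
rewrite leq_add2r leq_mul2l /= => le.
have degE B : \sum_(y | y != x) w B x y = #|[set y | e x y && ((x \in B) != (y \in B))]|.
  rewrite -sum1_card big_mkcond [RHS]big_mkcond /=; apply: eq_bigr => y _.
  rewrite inE /w; case: eqP => [->|_] /=; first by rewrite e_irr.
  by case: (e x y && _).
rewrite !degE in le.
have -> : [set y | e x y] = [set y | e x y && ((x \in A) != (y \in A))] :|:
    [set y | e x y && ((x \in A') != (y \in A'))].
  apply/setP => y; rewrite !inE eqxx addbT.
  case: (eqVneq y x) => [->|yx]; first by rewrite e_irr.
  by rewrite addbF; case: (e x y); case: (x \in A); case: (y \in A).
apply: leq_trans (leq_card_setU _ _) _; rewrite mul2n -addnn leq_add2l; exact: le.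
Qed.

Variables (T : finType) (e : rel T).
Hypothesis e_sym : symmetric e.
Hypothesis e_irr : irreflexive e.

(** Pairs are ordered, so each edge counts twice. *)
Definition arcs (S : {set T}) : {set T * T} :=
  [set p | [&& p.1 \in S, p.2 \in S & e p.1 p.2]].

Definition cut_within (U A : {set T}) : rel T :=
  fun x y => [&& e x y, x \in U, y \in U & (x \in A) != (y \in A)].

Lemma arcs_sum (S : {set T}) : #|arcs S| = \sum_(x in S) #|[set y in S | e x y]|.
Proof.
rewrite card_pairs_fst [RHS]big_mkcond /=; apply: eq_bigr => x _; case: ifP => xS.
  by apply: eq_card => y; rewrite !inE xS.
by apply/eqP; rewrite cards_eq0; apply/eqP/setP => y; rewrite !inE xS.
Qed.

(** In a smallest dense set every smaller subset is sparse, so vertices of degree above [t] times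
    the average carry few arcs and can be deleted. Pruning and a maximum cut give the lower degree
    bound. *)
Lemma regular_subgraph kk C (t := 4 ^ kk * 2 ^ kk.+1) : 0 < kk -> 32 <= C ->
  C ^ kk * #|T| ^ kk.+1 < #|arcs setT| ^ kk ->
  exists (U A : {set T}) d, [/\ U != set0, C ^ kk * #|U| < (32 * d) ^ kk,
    C < 32 * d,
    forall x, x \in U -> d <= #|[set y | cut_within U A x y]| &
    forall x, #|[set y | cut_within U A x y]| <= 32 * t * d].
Proof.
move=> k0 C32; rewrite -cardsT => dT.
have t0 : 4 <= t.
  apply: (@leq_trans (4 ^ kk)); first by rewrite -{1}(expn1 4) leq_pexp2l.
  by rewrite leq_pmulr // expn_gt0.
pose dense (S : {set T}) := C ^ kk * #|S| ^ kk.+1 < #|arcs S| ^ kk.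
case: (arg_minnP (fun S : {set T} => #|S|) (dT : dense setT)) => S Sd Smin.
set E := #|arcs S| in Sd; set m := #|S| in Sd Smin.
have m0 : 0 < m.
  rewrite lt0n; apply/negP => /eqP mE; move: Sd; rewrite /dense.
  have -> : #|arcs S| = 0 by rewrite arcs_sum (cards0_eq mE) big_set0.
  by rewrite exp0n.
have {}Sd : C ^ kk * m ^ kk.+1 < E ^ kk by [].
have EC : C * m < E.
  rewrite -(ltn_exp2r _ _ k0); apply: leq_ltn_trans Sd.
  by rewrite expnMn leq_mul2l leq_pexp2l // orbT.
have E0 : 0 < E by lia.
pose deg x := #|[set y in S | e x y]|.
pose H := [set x in S | t * E < deg x * m].
have HS : H \subset S by apply/subsetP => x; rewrite inE => /andP[].
have ES : E = \sum_(x in S) deg x by rewrite /E arcs_sum.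
have Hq : #|H| <= m %/ t.
  rewrite leq_divRL; last lia.
  rewrite -(leq_pmul2r E0) -mulnA -sum_nat_const.
  apply: (@leq_trans (\sum_(x in H) deg x * m)).
    by apply: leq_sum => x; rewrite inE => /andP[_ /ltnW].
  rewrite -big_distrl /= mulnC leq_mul2l; apply/orP; right.
  by rewrite ES [X in _ <= X](big_setID H) /= (setIidPr HS) leq_addr.
set q := m %/ t in Hq; have qm : q * t <= m by exact: leq_divM.
pose EH := \sum_(x in H) deg x.
(* Otherwise some [q] vertices [P], with at least average adjacency to [H], would make [H :|: P]
   span at least [q * E / (4 * m)] arcs on at most [2 * q < m] vertices. Its sparsity then forces
   [m < q * t]; [t] is chosen for this contradiction. *)
have EHE : 4 * EH < E.
  rewrite ltnNge; apply/negP => EH4.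
  pose dH y := #|[set x in H | e x y]|.
  have [|P [PS Pq Psum]] := @large_average_subset T dH q S.
    by rewrite -/m; nia.
  have q0 : 0 < q.
    rewrite lt0n; apply/negP => /eqP q0; move: Hq; rewrite q0 leqn0 cards_eq0 => /eqP H0.
    by move: EH4; rewrite /EH H0 big_set0; lia.
  have dHE : \sum_(y in S) dH y = EH.
    rewrite /EH /dH /deg.
    transitivity (\sum_(y in S) \sum_(x in H) (e x y : nat)).
      apply: eq_bigr => y _; rewrite -sum1_card -big_mkcondr /=.
      by apply: eq_bigl => x; rewrite inE.
    rewrite exchange_big /=; apply: eq_bigr => x _; rewrite -sum1_card -big_mkcondr /=.
    by apply: eq_bigl => y; rewrite inE.
  have arcsP : \sum_(y in P) dH y <= #|arcs (H :|: P)|.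
    rewrite card_pairs_snd [X in _ <= X](bigID (mem P)) /=.
    apply: leq_trans (leq_addr _ _); apply: leq_sum => y yP.
    apply/subset_leq_card/subsetP => x; rewrite [x \in [set _ in H | _]]inE => /andP[xH xy].
    by rewrite 2!in_set /= !in_setU xH yP xy orbT.
  have HPc : #|H :|: P| <= 2 * q.
    by apply: leq_trans (leq_card_setU _ _) _; rewrite Pq; lia.
  have : ~~ dense (H :|: P).
    apply/negP => /Smin; rewrite -/m; nia.
  rewrite /dense -leqNgt => sparse.
  have h1 : q * E <= 4 * m * #|arcs (H :|: P)|.
    apply: (@leq_trans (q * (4 * EH))); first by rewrite leq_mul2l EH4 orbT.
    rewrite mulnCA -mulnA leq_mul2l /= -dHE; apply: leq_trans Psum _.
    by rewrite leq_mul2l arcsP orbT.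
  have h2 : (q * E) ^ kk <= (4 * m * #|arcs (H :|: P)|) ^ kk by rewrite leq_exp2r.
  have h3 : (4 * m * #|arcs (H :|: P)|) ^ kk <= (4 * m) ^ kk * (C ^ kk * (2 * q) ^ kk.+1).
    rewrite expnMn leq_mul2l; apply/orP; right; apply: leq_trans sparse _.
    by rewrite leq_mul2l leq_exp2r // HPc orbT.
  have h4 : q ^ kk * (C ^ kk * m ^ kk.+1) < q ^ kk * E ^ kk.
    by rewrite ltn_pmul2l // expn_gt0 q0.
  have h5 : (4 * m) ^ kk * (C ^ kk * (2 * q) ^ kk.+1) = (q ^ kk * C ^ kk * m ^ kk) * (q * t).
    rewrite /t !expnMn !expnS; lia.
  have h6 : (q ^ kk * C ^ kk * m ^ kk) * m < (q ^ kk * C ^ kk * m ^ kk) * (q * t).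
    rewrite -h5; apply: leq_trans h3; apply: leq_trans h2; rewrite expnMn.
    by apply: leq_trans h4; rewrite expnS; lia.
  by move: h6; rewrite ltn_mul2l => /andP[_]; lia.
have Hdeg x : x \in S -> x \notin H -> deg x * m <= t * E.
  by move=> xS; rewrite inE xS -leqNgt.
clearbody H; pose S2 := S :\: H.
have E2 : E <= 2 * #|arcs S2|.
  have : E <= #|arcs S2| + 2 * EH.
    have HE : \sum_(x in H) deg x = #|[set p in arcs S | p.1 \in H]|.
      rewrite card_pairs_fst big_mkcond /=; apply: eq_bigr => x _; case: ifP => xH.
        by apply: eq_card => y; rewrite !inE /= xH (subsetP HS _ xH) andbT.
      by apply/esym/eq_card0 => y; rewrite !inE /= xH andbF.
    have HE' : \sum_(x in H) deg x = #|[set p in arcs S | p.2 \in H]|.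
      rewrite card_pairs_snd big_mkcond /=; apply: eq_bigr => x _; case: ifP => xH.
        by apply: eq_card => y; rewrite !inE /= xH (subsetP HS _ xH) andbT e_sym.
      by apply/esym/eq_card0 => y; rewrite !inE /= xH andbF.
    rewrite mul2n -addnn {1}/EH HE /EH HE' addnA.
    apply: leq_trans (leq_trans (leq_card_setU (arcs S2 :|: [set p in arcs S | p.1 \in H])
      [set p in arcs S | p.2 \in H]) _); last by rewrite leq_add2r leq_card_setU.
    apply/subset_leq_card/subsetP => -[x y]; rewrite !inE /=.
    by case: (x \in S); case: (y \in S); case: (e x y); case: (x \in H); case: (y \in H).
  lia.
(* Pruning to a quarter of the average degree loses at most [E / 4] arcs, fewer than [arcs S2] has,
   so [U] is nonempty. *)
pose D := E %/ (4 * m).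
have S2m : #|S2| <= m by apply/subset_leq_card/subsetDl.
have DE : D * (4 * m) <= E by exact: leq_divM.
have [|U [US2 EU Udeg]] := @prune _ (arcs S2) S2 D.
  by apply/subsetP => -[x y]; rewrite in_set /= in_setX => /and3P[-> ->].
have arcsU : arcs S2 :&: setX U U = arcs U.
  apply/setP => -[x y]; rewrite in_setI in_setX !in_set /=.
  case: (boolP (x \in U)) => xU; case: (boolP (y \in U)) => yU; rewrite ?andbF ?andbT //=.
  by have := subsetP US2 _ xU; have := subsetP US2 _ yU; rewrite !in_set => -> ->.
rewrite arcsU in EU Udeg.
have degU x : x \in U -> D <= 2 * #|[set y in U | e x y]|.
  move=> xU; apply: leq_trans (Udeg _ xU) _.
  have sub : incident (arcs U) x \subset
      (fun y => (x, y)) @: [set y in U | e x y] :|: (fun y => (y, x)) @: [set y in U | e x y].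
    apply/subsetP => -[y z]; rewrite in_set in_set /= => /andP[/and3P[yU zU yz]] /orP[]/eqP E'.
      by rewrite in_setU E' imset_f // inE zU -E'.
    by rewrite in_setU E' orbC imset_f // inE yU e_sym -E'.
  apply: leq_trans (subset_leq_card sub) _; apply: leq_trans (leq_card_setU _ _) _.
  by rewrite mul2n -addnn leq_add // leq_imset_card.
have U0 : U != set0.
  apply/eqP => UE; move: EU; rewrite UE.
  have -> : #|arcs set0| = 0 by rewrite arcs_sum big_set0.
  have : D * #|S2| <= D * m by rewrite leq_mul2l S2m orbT.
  lia.
have [A Acut] : exists A : {set T}, forall x,
   #|[set y | [&& e x y, x \in U & y \in U]]| <=
   2 * #|[set y | [&& e x y, x \in U & y \in U] && ((x \in A) != (y \in A))]|.
  by apply: max_cut => [x y|x]; [rewrite e_sym andbCA andbC -andbA andbCA|rewrite e_irr].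
have cutE x y : cut_within U A x y = [&& e x y, x \in U & y \in U] && ((x \in A) != (y \in A)).
  by rewrite /cut_within !andbA.
(* One factor 2 is lost because [incident] counts both orders of an edge, the other to the cut. *)
pose d := D %/ 4; have Dd : D < 4 * d.+1 by rewrite mulnC -ltn_divLR.
have Em : E < (4 * m) * D.+1 by rewrite mulnC -ltn_divLR // muln_gt0.
have Edm : E < 16 * m * d.+1.
  apply: leq_trans Em _; have : 4 * m * D.+1 <= 4 * m * (4 * d.+1) by rewrite leq_mul2l Dd orbT.
  lia.
have Cd : C < 16 * d.+1.
  by rewrite -(ltn_pmul2r m0); apply: leq_trans EC _; apply: leq_trans (ltnW Edm) _; lia.
have d0 : 0 < d by lia.
have Ed : E < m * (32 * d).
  apply: leq_trans Edm _; rewrite -mulnA mulnCA leq_mul2l; apply/orP; right; lia.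
exists U, A, d; split => //.
- have mk0 : 0 < m ^ kk by rewrite expn_gt0 m0.
  rewrite -(ltn_pmul2l mk0) -expnMn.
  apply: leq_trans (_ : E ^ kk <= _); last by rewrite leq_exp2r // ltnW.
  apply: leq_ltn_trans Sd; rewrite mulnCA leq_mul2l expnSr leq_mul2l; apply/orP; right.
  apply/orP; right; apply: leq_trans S2m; exact: subset_leq_card.
- lia.
- move=> x xU; have h1 := degU x xU; have h2 := Acut x.
  have -> : [set y | cut_within U A x y] =
      [set y | [&& e x y, x \in U & y \in U] && ((x \in A) != (y \in A))].
    by apply/setP => y; rewrite !inE cutE.
  have h3 : [set y in U | e x y] = [set y | [&& e x y, x \in U & y \in U]].
    by apply/setP => y; rewrite !inE xU andbC.
  rewrite h3 in h1.
  have : d * 4 <= D by exact: leq_divM.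
  lia.
- move=> x; case: (boolP (x \in U)) => xU; last first.
    rewrite (_ : [set y | _] = set0) ?cards0 //.
    by apply/setP => y; rewrite !inE /cut_within (negbTE xU) /= andbF.
  have := subsetP US2 _ xU; rewrite inE => /andP[xH xS]; have xdeg := Hdeg x xS xH.
  apply: (@leq_trans (deg x)).
    apply/subset_leq_card/subsetP => y; rewrite !inE => /and4P[-> _ yU _].
    by have := subsetP US2 _ yU; rewrite inE => /andP[_ ->].
  rewrite -(leq_pmul2r m0); apply: leq_trans xdeg _.
  have : t * E <= t * (m * (32 * d)) by rewrite leq_mul2l (ltnW Ed) orbT.
  lia.
Qed.

End Regularization.

(** * The arc bound for theta-free graphs *)

Section Extremal.
Set Implicit Arguments. Unset Strict Implicit.

Lemma bigminn_le (I : eqType) (r : seq I) (P : pred I) (F : I -> nat) z j :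
  j \in r -> P j -> \big[minn/z]_(i <- r | P i) F i <= F j.
Proof.
elim: r => // i r IH; rewrite inE big_cons => /predU1P[<- ->|jr Pj].
  exact: geq_minl.
by case: ifP => _; [apply: leq_trans (geq_minr _ _) _|]; exact: IH.
Qed.

Lemma min_pair_sum_le l (k : 'I_l -> nat) a b :
  a != b -> theta_min_pair_sum k <= k a + k b.
Proof.
wlog ab : a b / a < b => [H|_].
  case: (ltngtP a b) => [lt|gt|/val_inj->]; [exact: H| |by rewrite eqxx].
  by rewrite eq_sym addnC; exact: H.
apply: (@bigminn_le _ _ (fun ij : 'I_l * 'I_l => ij.1 < ij.2)
  (fun ij => k ij.1 + k ij.2) _ (a, b)) => //; exact: mem_index_enum.
Qed.

Lemma min_pair_sum_attained l (k : 'I_l -> nat) : 2 <= l ->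
  exists a b, a != b /\ theta_min_pair_sum k = k a + k b.
Proof.
move=> l2; have l0 : 0 < l by lia.
pose a0 : 'I_l := Ordinal l0; pose b0 : 'I_l := Ordinal l2.
have ab : a0 != b0 by [].
have [E|[[a b] /= lt E]] : theta_min_pair_sum k = \sum_(i < l) k i \/
    exists2 ij : 'I_l * 'I_l, ij.1 < ij.2 & theta_min_pair_sum k = k ij.1 + k ij.2.
  apply: (big_rec (fun m => m = \sum_(i < l) k i \/
      exists2 ij : 'I_l * 'I_l, ij.1 < ij.2 & m = k ij.1 + k ij.2)) => [|ij m lt IH].
    by left.
  rewrite /minn; case: ifP => _; [by right; exists ij|].
  by case: IH => [|[ij' ? ?]]; [left|right; exists ij'].
  (* The default sum is at least [k a0 + k b0], so if it is the minimum, this pair attains it. *)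
  exists a0, b0; split => //; apply/eqP; rewrite eqn_leq min_pair_sum_le //=.
  rewrite E (bigD1 a0) //= (bigD1 b0) //= ?addnA ?leq_addr //.
exists a, b; split => //; apply: contraTneq lt => ->; by rewrite ltnn.
Qed.

Lemma theta_free_arcs l (k : 'I_l -> nat) (a1 : 'I_l) kk :
  (forall a, k a1 <= k a) -> 0 < k a1 ->
  (forall a, a != a1 -> 2 * kk <= k a1 + k a) ->
  (forall a, odd (k a) = odd (k a1)) -> 0 < kk ->
  exists2 C, 0 < C & forall (T : finType) (e : rel T),
    symmetric e -> irreflexive e -> ~ contains_subgraph e (theta_adj k) ->
    #|arcs e setT| ^ kk <= C ^ kk * #|T| ^ kk.+1.
Proof.
move=> kmin k1 kpair kodd kk0.
set c := density_const k kk; set K := 32 * (4 ^ kk * 2 ^ kk.+1).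
have N0 : 0 < theta_size k by rewrite /theta_size; have := ltn_ord a1; lia.
have c0 : 0 < c by rewrite /c /density_const !muln_gt0 expn_gt0 N0; lia.
have K0 : 0 < K by rewrite /K !muln_gt0 !expn_gt0.
set x := 2 * c * (K * (4 * c)) ^ kk.
(* The summand [x] gives the lower bound on [d] that [growth] needs; the summand [4 * c] makes its
   conclusion contradict the density of [U]. *)
exists (32 * (x + 4 * c)); first by lia.
move=> T e e_sym e_irr noT; rewrite leqNgt; apply/negP => big.
have [|U [A [d [U0 dU Cd dmin dmax]]]] := regular_subgraph e_sym e_irr kk0 _ big.
  by lia.
have h : d ^ kk <= (4 * c) ^ kk * #|U|.
  apply: (@growth T (cut_within e U A) l k a1 kk _ kmin k1 kpair kodd kk0 A U d K) => //.
  - move=> y z; rewrite /cut_within e_sym [(z \in A) == _]eq_sym.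
    by case: (y \in U); case: (z \in U).
  - by move=> y z /and4P[].
  - by move=> y z /and4P[].
  - by rewrite -/c -/x; lia.
  - move=> [f [finj fe]]; apply: noT; exists f; split=> // y z /fe.
    by case/and4P.
move: dU; rewrite ltnNge expnMn => /negP; apply.
apply: leq_trans (_ : 32 ^ kk * ((4 * c) ^ kk * #|U|) <= _).
  by rewrite leq_mul2l h orbT.
by rewrite mulnA -expnMn leq_mul2r leq_exp2r //; apply/orP; right; lia.
Qed.

Lemma num_edges_le_arcs (T : finType) (e : rel T) : num_edges e <= #|arcs e setT|.
Proof.
apply: leq_trans (leq_imset_card (fun p => [set p.1; p.2]) (arcs e setT)).
apply/subset_leq_card/subsetP => E; rewrite inE.
move=> /existsP[x /existsP[y /andP[/andP[_ xy] /eqP ->]]].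
by apply/imsetP; exists (x, y); rewrite // !inE.
Qed.

End Extremal.

(** * Translation to real exponents *)

Local Open Scope ring_scope.

Theorem theorem1p1 (R : realType) (l : nat) (k : 'I_l -> nat) :
  (2 <= l)%N ->
  (forall i, (0 < k i)%N) ->
  (forall i j, odd (k i) = odd (k j)) ->
  (forall i j, k i = 1%N -> k j = 1%N -> i = j) ->
  exists C : R, 0 < C /\
    forall (n : nat) (e : rel 'I_n),
      symmetric e -> irreflexive e ->
      ~ contains_subgraph e (theta_adj k) ->
      (num_edges e)%:R <= C * powR (n%:R) (1 + (kstar R k)^-1).
Proof.
move=> l2 k0 kodd _.
have l0 : (0 < l)%N by lia.
have [a1 _ kmin] := arg_minnP k (erefl true : predT (Ordinal l0)).
have [a [b [_ mE]]] := min_pair_sum_attained k l2.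
(* Equal parities make the least pair sum even, so [kstar] is the integer [kk]. *)
pose kk := (theta_min_pair_sum k)./2.
have kkE : theta_min_pair_sum k = (2 * kk)%N.
  have := odd_double_half (theta_min_pair_sum k).
  by rewrite {1}mE oddD (kodd a b) addbb add0n mul2n.
have kk0 : (0 < kk)%N by have := k0 a; have := k0 b; lia.
have [|||||C C0 CP] := @theta_free_arcs l k a1 kk.
- by move=> i; exact: kmin.
- exact: k0.
- by move=> i ia; rewrite -kkE addnC; exact: min_pair_sum_le.
- by [].
- by [].
exists C%:R; split; first by rewrite ltr0n.
move=> n e e_sym e_irr noT.
have kE : kstar R k = kk%:R.
  by rewrite /kstar kkE natrM mulrC mulKf // pnatr_eq0.
have Y0 : 0 <= C%:R * powR (n%:R : R) (1 + (kstar R k)^-1).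
  by rewrite mulr_ge0 ?powR_ge0.
(* The power [kk] turns the exponent [1 + 1 / kk] into the integer [kk + 1]. *)
rewrite -(ler_pXn2r kk0) ?nnegrE //.
rewrite exprMn -[(powR _ _) ^+ _]powR_mulrn ?powR_ge0 // -powRrM kE mulrDl mul1r.
rewrite mulVf ?pnatr_eq0 -?lt0n // -[1]/(1%:R) -natrD powR_mulrn // addn1.
rewrite -!natrX -natrM ler_nat.
apply: leq_trans (_ : (#|arcs e setT| ^ kk <= _)%N).
  by rewrite leq_exp2r // num_edges_le_arcs.
by have := CP _ e e_sym e_irr noT; rewrite card_ord.
Qed.
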